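(* Fix a sign $\pm$. Let $N\ge1$, $\vec m=(m_1,\dots,m_N)\in\mathbb Z_+^N$, and let $\vec s=(s_1,\dots,s_N)\in\mathbb C^N$ satisfy condition $(\star\pm)$. Let $V$ be a quasifinite $\mathfrak g^{[\vec m]}$-module, regarded as a $\hat{\mathcal D}^\pm$-module via the homomorphism $\hat\phi^{[\vec m]}_{\vec s}:\hat{\mathcal D}^\pm\to\mathfrak g^{[\vec m]}$. Then any $\hat{\mathcal D}^\pm$-submodule of $V$ is also a $\mathfrak g^{[\vec m]}$-submodule. In particular, for quasifinite weights $\Lambda(i)\in(\mathfrak g^{[m_i]}_0)^*$ ($i=1,\dots,N$) the $\hat{\mathcal D}^\pm$-module $L^{[\vec m],\pm}_{\vec s}(\vec\Lambda)$ is irreducible.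
   Context: **The algebras $\hat{\mathcal D}^\pm$.** $\hat{\mathcal D}=\mathcal D\oplus\mathbb CC$, where $\mathcal D$ is spanned by $t^kf(D)$ ($k\in\mathbb Z$, $f\in\mathbb C[w]$, $D=t\frac d{dt}$), $C$ is central and $[t^rf(D),t^sg(D)]=t^{r+s}(f(D+s)g(D)-f(D)g(D+r))+\Psi\,C$, with $\Psi$ antisymmetric, $\Psi=\sum_{-r\le j\le-1}f(j)g(j+r)$ if $r=-s\ge0$, $\Psi=0$ if $r+s\ne0$; $\deg t^kf(D)=k$, $\deg C=0$. $\hat{\mathcal D}^-$ is the subalgebra spanned by $C$ and $t^kg(D+k/2)$ with $g$ odd if $k$ is even, $g$ even if $k$ is odd. $\hat{\mathcal D}^+$ is the subalgebra spanned by $C$ and $t^kg(D+(k+1)/2)$ with $g$ odd. **Matrix algebras.** $R_m=\mathbb C[u]/(u^{m+1})$. $\mathfrak{gl}^{[m]}$ is the Lie algebra of matrices $(a_{ij})_{i,j\in\mathbb Z}$ over $R_m$ with finitely many nonzero diagonals; $\widehat{\mathfrak{gl}}^{[m]}=\mathfrak{gl}^{[m]}\oplus R_m$ is the central extension by the $R_m$-valued cocycle $\mathrm{Tr}([J,A]B)$, $J=\sum_{i\le0}E_{ii}$. It is graded by $\deg E_{ij}=j-i$, $\deg R_m=0$. Let $b^{[m]}_\infty,\tilde b^{[m]}_\infty,c^{[m]}_\infty,d^{[m]}_\infty$ be the subalgebras (matrices of the indicated kind) $\oplus R_m$, with the induced cocycle and gradation: - $b_\infty^{[m]}$: $a_{ij}(u)=(-1)^{i+j+1}a_{-j,-i}(-u)$;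 - $\tilde b_\infty^{[m]}$: $a_{ij}(u)=-a_{-j,-i}(-u)$; - $c_\infty^{[m]}$: $a_{ij}(u)=(-1)^{i+j+1}a_{1-j,1-i}(-u)$; - $d_\infty^{[m]}$: $a_{ij}(u)=-a_{1-j,1-i}(-u)$. **Homomorphisms.** For $s\in\mathbb C$ put $\phi^{[m]}_s(t^kf(D))=\sum_{j}f(s-j+u)E_{j-k,j}$, where $f(s-j+u)=\sum_{i=0}^mf^{(i)}(s-j)u^i/i!$. The homomorphism $\hat\phi_s^{[m]}:\hat{\mathcal D}\to\widehat{\mathfrak{gl}}^{[m]}$ is $\hat\phi_s^{[m]}(C)=1\in R_m$; $\hat\phi_s^{[m]}=\phi_s^{[m]}$ on degree $k\neq0$; and, as an identity of power series in $x$, $$\hat\phi^{[m]}_s(e^{xD})=\phi_s^{[m]}(e^{xD})-\frac{e^{sx}-1}{e^x-1}\,1-\sum_{i=1}^m\frac{x^ie^{sx}}{i!\,(e^x-1)}u^i .$$ It is restricted to $\hat{\mathcal D}^\pm$. **Condition $(\star-)$ (resp. $(\star+)$):** $s_i\in\mathbb Z$ implies $s_i=0$; $s_i\in\frac12+\mathbb Z$ implies $s_i=\frac12$ (resp. $s_i=-\frac12$); and $s_i\not\equiv\pm s_j\pmod{\mathbb Z}$ for $i\ne j$. **$\mathfrak g^{[\vec m]}$.** $\mathfrak g^{[\vec m]}=\bigoplus_i\mathfrak g^{[m_i]}$. In the $-$ case, $\mathfrak g^{[m_i]}=b_\infty^{[m_i]},c_\infty^{[m_i]},\widehat{\mathfrak{gl}}^{[m_i]}$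 according to $s_i=0$, $s_i=\frac12$, $s_i\notin\frac12\mathbb Z$. In the $+$ case, $\mathfrak g^{[m_i]}=d_\infty^{[m_i]},\tilde b_\infty^{[m_i]},\widehat{\mathfrak{gl}}^{[m_i]}$ according to $s_i=0$, $s_i=-\frac12$, $s_i\notin\frac12\mathbb Z$. $\hat\phi_{\vec s}^{[\vec m]}=\bigoplus_i\hat\phi_{s_i}^{[m_i]}$. **Modules.** A module $V=\bigoplus_jV_j$ over a $\mathbb Z$-graded Lie algebra $\mathfrak g$ is graded if $\mathfrak g_iV_j\subset V_{j-i}$, and quasifinite if moreover all $\dim V_j<\infty$. $L(\mathfrak g^{[m]};\Lambda)$, $\Lambda\in(\mathfrak g^{[m]}_0)^*$, is the irreducible highest weight module (highest weight vector killed by positive degree elements); $\Lambda$ is called quasifinite if this module is. $L^{[\vec m],\pm}_{\vec s}(\vec\Lambda)$ is the outer tensor product $\bigotimes_iL(\mathfrak g^{[m_i]};\Lambda(i))$ viewed as a $\hat{\mathcal D}^\pm$-module via $\hat\phi^{[\vec m]}_{\vec s}$. Convention: for each $i$ with $s_i\in\frac12\mathbb Z$, the central elements $u^j\in R_{m_i}$ with $j$ odd act by $0$ on all $\mathfrak g^{[\vec m]}$-modules considered. *)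

(* Defs.v *)
From HB Require Import structures.
From mathcomp Require Import all_boot all_order all_algebra.
From mathcomp Require Import complex.
From mathcomp Require Import all_classical all_reals.

Set Implicit Arguments.
Unset Strict Implicit.
Unset Printing Implicit Defensive.

Import Order.TTheory GRing.Theory Num.Theory.

Local Open Scope classical_set_scope.
Local Open Scope ring_scope.

(** * Modules over Lie algebras *)

(* A Lie algebra is given by a subset [g] of an ambient vector space [L],
   stable under a bracket [br] defined on all of [L].  Actions are functions on
   [L], about which nothing is known outside [g]. *)
Section LieModules.
Variables (K : fieldType) (L V : lmodType K).
Variables (g : set L) (br : L -> L -> L) (deg : int -> set L).
Variable act : L -> V -> V.

Definition lie_module : Prop :=
  [/\ forall x, g x -> linear (act x),
      forall (v : V) (a : K) (x y : L), g x -> g y ->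
        act (a *: x + y) v = a *: act x v + act y v
    & forall (x y : L) (v : V), g x -> g y ->
        act (br x y) v = act x (act y v) - act y (act x v)].

Definition subspace (W : set V) : Prop :=
  W 0 /\ forall (a : K) (u v : V), W u -> W v -> W (a *: u + v).

Definition submodule (W : set V) : Prop :=
  subspace W /\ forall x v, g x -> W v -> W (act x v).

Definition irreducible_module : Prop :=
  [/\ lie_module, exists v : V, v <> 0
    & forall W : set V, submodule W -> W = [set 0] \/ W = setT].

Definition is_grading (Vd : int -> set V) : Prop :=
  (forall j, subspace (Vd j)) /\
  forall v : V, exists! w : int -> V,
    [/\ finite_set [set j | w j <> 0], forall j, Vd j (w j)
      & v = \sum_(j \in setT) w j].

Definition finite_dimensional (W : set V) : Prop :=
  exists (n : nat) (e : 'I_n -> V), (forall i, W (e i)) /\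
    forall v, W v -> exists c : 'I_n -> K, v = \sum_(i < n) c i *: e i.

(* [deg k] is the set of elements of [L] that are homogeneous of degree [k]. *)
Definition graded_module (Vd : int -> set V) : Prop :=
  is_grading Vd /\
  forall i j x v, g x -> deg i x -> Vd j v -> Vd (j - i) (act x v).

Definition quasifinite : Prop :=
  lie_module /\
  exists Vd, graded_module Vd /\ forall j, finite_dimensional (Vd j).

(* [V] is a model of L(g; Lam).  Generation by the highest weight vector is
   automatic from irreducibility, and such a [V] is unique up to isomorphism.
   Only the values of [Lam] on the degree-0 part of [g] matter. *)
Definition irr_highest_weight_module (Lam : L -> K) : Prop :=
  [/\ forall a x y, g x -> deg 0 x -> g y -> deg 0 y ->
        Lam (a *: x + y) = a * Lam x + Lam y,
      irreducible_module
    & exists v : V, [/\ v <> 0,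
        forall k x, 0 < k -> g x -> deg k x -> act x v = 0
      & forall h, g h -> deg 0 h -> act h v = Lam h *: v]].

End LieModules.

(** * Direct sums and tensor products of finite families *)

Section FiniteFamilies.
Variables (K : fieldType) (N : nat).

Definition dsum (M : 'I_N -> lmodType K) : Type := forall i, M i.

Section DSumLmod.
Variable M : 'I_N -> lmodType K.
Implicit Types x y z : dsum M.

HB.instance Definition _ := gen_eqMixin (dsum M).
HB.instance Definition _ := gen_choiceMixin (dsum M).

Definition dsum0 : dsum M := fun i => 0.
Definition dsumD x y : dsum M := fun i => x i + y i.
Definition dsumN x : dsum M := fun i => - x i.
Definition dsumZ (a : K) x : dsum M := fun i => a *: x i.

Let dsumA : associative dsumD.
Proof. by move=> x y z; apply: functional_extensionality_dep => i; apply: addrA. Qed.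
Let dsumC : commutative dsumD.
Proof. by move=> x y; apply: functional_extensionality_dep => i; apply: addrC. Qed.
Let dsum0x : left_id dsum0 dsumD.
Proof. by move=> x; apply: functional_extensionality_dep => i; apply: add0r. Qed.
Let dsumNx : left_inverse dsum0 dsumN dsumD.
Proof. by move=> x; apply: functional_extensionality_dep => i; apply: addNr. Qed.

HB.instance Definition _ :=
  GRing.isZmodule.Build (dsum M) dsumA dsumC dsum0x dsumNx.

Let dsumZA (a b : K) x : dsumZ a (dsumZ b x) = dsumZ (a * b) x.
Proof. by apply: functional_extensionality_dep => i; apply: scalerA. Qed.
Let dsum1Z : left_id 1 dsumZ.
Proof. by move=> x; apply: functional_extensionality_dep => i; apply: scale1r. Qed.
Let dsumZDr : right_distributive dsumZ +%R.
Proof. by move=> a x y; apply: functional_extensionality_dep => i; apply: scalerDr. Qed.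
Let dsumZDl x (a b : K) : dsumZ (a + b) x = dsumZ a x + dsumZ b x.
Proof. by apply: functional_extensionality_dep => i; apply: scalerDl. Qed.

HB.instance Definition _ :=
  GRing.Zmodule_isLmodule.Build K (dsum M) dsumZA dsum1Z dsumZDr dsumZDl.

End DSumLmod.

(* [v] with its [i]-th component replaced by [x] *)
Definition upd (M : 'I_N -> lmodType K) (v : forall i, M i) (i : 'I_N)
    (x : M i) : forall i, M i :=
  @eqtype.dfwith _ (fun i => M i : Type) v i x.

Definition multilinear (M : 'I_N -> lmodType K) (T : lmodType K)
    (f : (forall i, M i) -> T) : Prop :=
  forall (i : 'I_N) (v : forall i, M i) (a : K) (x y : M i),
    f (upd v (a *: x + y)) = a *: f (upd v x) + f (upd v y).

Definition is_tensor_product (M : 'I_N -> lmodType K) (T : lmodType K)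
    (tau : (forall i, M i) -> T) : Prop :=
  multilinear tau /\
  forall (W : lmodType K) (f : (forall i, M i) -> W), multilinear f ->
    (exists h : {linear T -> W}, forall v, h (tau v) = f v) /\
    (forall h h' : {linear T -> W},
      (forall v, h (tau v) = h' (tau v)) -> forall t, h t = h' t).

End FiniteFamilies.

Section Algebras.
Variable R : realType.
Local Notation C := R[i].

Variant sign := Minus | Plus.

(** * The algebras [hat D] and [hat D^{+-}] *)

(* [(a, c)] stands for sum_k t^k a_k(D) + c C; only those with [a] of finite
   support belong to [hat D]. *)
Definition dhat : lmodType C := ((int -> {poly C}) * C^o)%type.

Definition fin_supp (a : int -> {poly C}) : Prop := finite_set [set k | a k <> 0].

(* [shift f z] is f(D + z). *)
Definition shift (f : {poly C}) (z : C) : {poly C} := f \Po ('X + z%:P).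

(* [Psi r f g] is the value of the cocycle on (t^r f(D), t^(-r) g(D)). *)
Definition Psi_pos (r : nat) (f g : {poly C}) : C :=
  \sum_(1 <= j < r.+1) f.[- j%:R] * g.[r%:R - j%:R].
Definition Psi (r : int) (f g : {poly C}) : C :=
  match r with
  | Posz n => Psi_pos n f g
  | Negz n => - Psi_pos n.+1 g f
  end.

Definition dhat_br (x y : dhat) : dhat :=
  ((fun n : int => \sum_(r \in [set: int])
      (shift (x.1 r) (n - r)%:~R * y.1 (n - r)
       - x.1 r * shift (y.1 (n - r)) r%:~R)),
   \sum_(r \in [set: int]) Psi r (x.1 r) (y.1 (- r))).

Definition odd_polynomial (f : {poly C}) : Prop := f \Po (- 'X) = - f.
Definition even_polynomial (f : {poly C}) : Prop := f \Po (- 'X) = f.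

Definition dhat_pm (e : sign) : set dhat :=
  [set x | fin_supp x.1 /\ forall k : int, exists f : {poly C},
     match e with
     | Minus => (if (2 %| k)%Z then odd_polynomial f else even_polynomial f)
                /\ x.1 k = shift f (k%:~R / 2)
     | Plus => odd_polynomial f /\ x.1 k = shift f ((k + 1)%:~R / 2)
     end].

(** * Matrix algebras *)

Local Notation Rm m := ({poly %/ ('X^(m.+1) : {poly R[i]})}).

Definition u_ (m : nat) : Rm m := qpolyX 'X^(m.+1).

(* The substitution u |-> -u. *)
Definition uopp (m : nat) (p : Rm m) : Rm m :=
  in_qpoly 'X^(m.+1) ((p : {poly C}) \Po (- 'X)).

Definition mat (m : nat) : lmodType C := (int -> int -> Rm m).

Definition mat_mul m (A B : mat m) : mat m :=
  fun i j => \sum_(k \in [set: int]) A i k * B k j.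
Definition mat_br m (A B : mat m) : mat m := mat_mul A B - mat_mul B A.
Definition mat_tr m (A : mat m) : Rm m := \sum_(i \in [set: int]) A i i.
Definition Jmat m : mat m := fun i j => ((i == j) && (i <= 0))%:R.

(* [(A, z)] stands for A + z, with z central. *)
Definition glhat (m : nat) : lmodType C := (mat m * Rm m)%type.

Definition glhat_br m (x y : glhat m) : glhat m :=
  (mat_br x.1 y.1, mat_tr (mat_mul (mat_br (Jmat m) x.1) y.1)).

Definition glhat_deg m (k : int) : set (glhat m) :=
  [set x | (forall i j, j - i <> k -> x.1 i j = 0) /\ (k <> 0 -> x.2 = 0)].

Definition gl_inf m : set (glhat m) :=
  [set x | exists b : nat, forall i j : int, (b < `|i - j|)%N -> x.1 i j = 0].

Definition b_inf m : set (glhat m) :=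
  [set x | gl_inf x /\ forall i j,
     x.1 i j = ((-1) ^ (i + j + 1) : C) *: uopp (x.1 (- j) (- i))].
Definition btilde_inf m : set (glhat m) :=
  [set x | gl_inf x /\ forall i j, x.1 i j = - uopp (x.1 (- j) (- i))].
Definition c_inf m : set (glhat m) :=
  [set x | gl_inf x /\ forall i j,
     x.1 i j = ((-1) ^ (i + j + 1) : C) *: uopp (x.1 (1 - j) (1 - i))].
Definition d_inf m : set (glhat m) :=
  [set x | gl_inf x /\ forall i j, x.1 i j = - uopp (x.1 (1 - j) (1 - i))].

(** * The homomorphisms [hat phi_s^{[m]}] *)

Definition taylor (m : nat) (f : {poly C}) (z : C) : Rm m :=
  \sum_(i < m.+1) (f^`(i).[z] / (i`!)%:R) *: u_ m ^+ i.

Definition phi (m : nat) (s : C) (a : int -> {poly C}) : mat m :=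
  fun i j => taylor m (a (j - i)) (s - j%:~R).

(* Formal power series in x over a C-module, as sequences of coefficients. *)
Definition exp_series (a : C) : nat -> C := fun n => a ^+ n / (n`!)%:R.

(* The quotient by e^x - 1 of a series F without constant term; see
   [quo_expm1P]. *)
Fixpoint quo_expm1_seq (M : lmodType C) (F : nat -> M) (n : nat) : seq M :=
  if n is n'.+1 then
    let q := quo_expm1_seq F n' in
    rcons q (F n - \sum_(k < n') ((n - k)`!)%:R^-1 *: nth 0 q k)
  else [::].
Definition quo_expm1 (M : lmodType C) (F : nat -> M) (n : nat) : M :=
  nth 0 (quo_expm1_seq F n.+1) n.

(* (e^{sx} - 1) 1 + sum_(1 <= i <= m) x^i e^{sx} / i! u^i *)
Definition center_num (m : nat) (s : C) : nat -> Rm m := fun n =>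
  (exp_series s n - (n == 0)%:R)%:A
  + \sum_(1 <= i < m.+1 | (i <= n)%N)
      (exp_series s (n - i) / (i`!)%:R) *: u_ m ^+ i.

(* The R_m-component of hat phi on degree 0: minus n! times the coefficient of
   x^n in the quotient is the image of D^n. *)
Definition phi_center (m : nat) (s : C) (f : {poly C}) : Rm m :=
  - \sum_(n < size f) (f`_n * (n`!)%:R) *: quo_expm1 (center_num m s) n.

Definition phihat (m : nat) (s : C) (x : dhat) : glhat m :=
  (phi m s x.1, phi_center m s (x.1 0) + (x.2 : C)%:A).

(** * The algebras [g^{[m]}] for vectors [m], [s] *)

Definition is_integer (z : C) : Prop := exists n : int, z = n%:~R.

Definition star (e : sign) N (s : 'I_N -> C) : Prop :=
  [/\ forall i, is_integer (s i) -> s i = 0,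
      forall i, is_integer (s i - 2^-1) ->
        s i = if e is Minus then 2^-1 else - 2^-1
    & forall i j, i <> j -> ~ is_integer (s i - s j) /\ ~ is_integer (s i + s j)].

(* Under [star] the last alternative is s \notin (1/2)Z. *)
Definition g_comp (e : sign) (m : nat) (s : C) : set (glhat m) :=
  match e with
  | Minus => if s == 0 then @b_inf m
             else if s == 2^-1 then @c_inf m else @gl_inf m
  | Plus => if s == 0 then @d_inf m
            else if s == - 2^-1 then @btilde_inf m else @gl_inf m
  end.

Section Vectors.
Variables (e : sign) (N : nat) (m : 'I_N -> nat) (s : 'I_N -> C).

Definition gvec_space : lmodType C := dsum (fun i => glhat (m i)).

Definition gvec : set gvec_space := [set x | forall i, g_comp e (s i) (x i)].
Definition gvec_br (x y : gvec_space) : gvec_space :=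
  fun i => glhat_br (x i) (y i).
Definition gvec_deg (k : int) : set gvec_space :=
  [set x | forall i, glhat_deg k (x i)].

Definition phihat_vec (x : dhat) : gvec_space := fun i => phihat (m i) (s i) x.

(* The central element [u^j] of the [i]-th summand. *)
Definition central_u (i : 'I_N) (j : nat) : gvec_space :=
  @upd _ _ (fun i => glhat (m i)) (fun=> 0) i (0, u_ (m i) ^+ j).

Definition odd_center_zero (V : lmodType C) (act : gvec_space -> V -> V) : Prop :=
  forall i, is_integer (2 * s i) -> forall j : nat, odd j ->
    forall v, act (central_u i j) v = 0.

(* The g^{[m]}-module structure of the outer tensor product of the L_i. *)
Definition outer_action (L : 'I_N -> lmodType C) (T : lmodType C)
    (tau : (forall i, L i) -> T)
    (actL : forall i, glhat (m i) -> L i -> L i)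
    (act : gvec_space -> T -> T) : Prop :=
  lie_module gvec gvec_br act /\
  forall x v, gvec x ->
    act x (tau v) = \sum_(i < N) tau (upd v (actL i (x i) (v i))).

End Vectors.

End Algebras.

(* Main.v *)
Require Import Defs.
From HB Require Import structures.
From mathcomp Require Import all_boot all_order all_algebra.
From mathcomp Require Import complex zify ring.
From mathcomp Require Import all_classical all_reals.

Set Implicit Arguments.
Unset Strict Implicit.
Unset Printing Implicit Defensive.

Import Order.TTheory GRing.Theory Num.Theory.

Local Open Scope classical_set_scope.
Local Open Scope ring_scope.

(* For a vector [v] of a quasifinite module, the matrices of degree [k <> 0] that
   kill the graded component of [v] form an ideal of finite codimension for the
   entrywise product.  Such an ideal contains every matrix whose entries vanish
   on a large enough interval of columns, so only finitely many entries matter on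
   [v], and Hermite interpolation realises them by an element of
   [t^k C[D]]: condition star keeps the interpolation points of distinct
   components, and their opposites, apart.  Hence a [D^{+-}]-submodule is stable in
   degrees [k <> 0]; degree 0 is spanned by brackets of degrees [r] and [-r] up to
   the odd central elements, which act by 0.

   An outer tensor product of irreducible highest weight modules is irreducible:
   with the spectral projections of an Euler element and the functionals it
   defines, a nonzero submodule is driven to the tensor product of the highest
   weight vectors, one factor at a time. *)

(** * Truncated polynomials *)

(** All the matrix algebras are handled at once: each consists of the matrices with a_ij = eta(j-i)
    a_{eps-j,eps-i}(-u), a relation imposed only when [b] holds, and - eta is a character of Z with
    values 1 and -1. In degree k, bracketing with a diagonal matrix d multiplies column j by d(j-k)
    - d(j). For k <> 0 every multiplier compatible with the symmetry arises in this way, whereas for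
    k = 0 the multiplier is always 0; hence the separate route through brackets in degree 0. There
    the symmetry leaves room only for constants even in u, which is where the convention on odd
    central elements enters. An ideal might consist of matrices vanishing on infinitely many common
    columns. The linear relation that finite dimension provides is therefore sought among bands
    polynomial in the column, which have finitely many zeros. The submodule argument is run for
    smooth modules instead of quasifinite ones because smoothness passes from the factors to a
    tensor product vector by vector. *)

Section TruncatedPolynomials.
Variable R : realType.
Local Notation C := R[i].
Local Notation Rm m := ({poly %/ ('X^(m.+1) : {poly R[i]})}).
Implicit Types (f g h : {poly C}) (z : C) (m : nat).

Definition tpoly m f : Rm m := in_qpoly 'X^(m.+1) f.

Lemma tpoly_is_linear m : linear (@tpoly m).
Proof. by move=> a f g; rewrite /tpoly in_qpolyD in_qpolyZ. Qed.
Lemma tpoly_is_monoid m : monoid_morphism (@tpoly m).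
Proof. by split; [exact: in_qpoly1 | exact: in_qpolyM]. Qed.
HB.instance Definition _ m :=
  GRing.isLinear.Build C {poly C} (Rm m) *:%R (@tpoly m) (@tpoly_is_linear m).
HB.instance Definition _ m :=
  GRing.isMonoidMorphism.Build {poly C} (Rm m) (@tpoly m) (@tpoly_is_monoid m).

Lemma mk_monicXn m : mk_monic ('X^(m.+1) : {poly C}) = 'X^(m.+1).
Proof. by rewrite /mk_monic size_polyXn monicXn. Qed.

Lemma tpoly_eq0 m f : (tpoly m f == 0) = ('X^(m.+1) %| f).
Proof.
have E : val (tpoly m f) = f %% 'X^(m.+1).
  by rewrite /= mk_monicXn Pdiv.IdomainMonic.modpE ?monicXn.
by rewrite -val_eqE E.
Qed.

Lemma tpolyK m (p : Rm m) : tpoly m (p : {poly C}) = p.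
Proof. by apply: val_inj; apply: in_qpoly_small; exact: size_mk_monic. Qed.

Lemma tpolyX m : tpoly m 'X = u_ R m. Proof. by []. Qed.

(** Taylor's formula: [taylor m f z] is the value of f at z + u in R_m, so it inherits all
    compatibilities of a composite of ring morphisms. *)
Lemma taylorE m f z : taylor m f z = tpoly m (f \Po ('X + z%:P)).
Proof.
have [n le_fn] : exists n, (size f <= n)%N by exists (size f).
have le_n : (size (map_poly polyC f) <= maxn n m.+1)%N.
  by rewrite (leq_trans (size_poly _ _)) // leq_max le_fn.
rewrite [f \Po _]/comp_poly (addrC 'X) (nderiv_taylor_wide (mulrC _ 'X) le_n).
rewrite linear_sum /= /taylor.
rewrite (big_ord_widen _ (fun i => (f^`(i).[z] / i`!%:R) *: u_ R m ^+ i)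
  (leq_maxr n m.+1)) big_mkcond /=.
apply: eq_bigr => i _; rewrite nderivn_map horner_map /= mul_polyC linearZ /=.
rewrite rmorphXn /= tpolyX; case: ltnP => [_|lt_mi].
  rewrite nderivn_def hornerMn -[in LHS]mulr_natr mulfK //.
  by rewrite pnatr_eq0 -lt0n fact_gt0.
have /eqP e : tpoly m 'X^i == 0 by rewrite tpoly_eq0 dvdp_exp2l.
by rewrite -tpolyX -rmorphXn /= e scaler0.
Qed.

Lemma uoppE m f : uopp (tpoly m f) = tpoly m (f \Po (- 'X)).
Proof.
have [q Eq] : exists q, (tpoly m f : {poly C}) = f + q * 'X^(m.+1).
  have : 'X^(m.+1) %| (tpoly m f : {poly C}) - f.
    by rewrite -tpoly_eq0 linearB subr_eq0; apply/eqP; apply: tpolyK.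
  by case/dvdpP => q Eq; exists q; rewrite -Eq addrC subrK.
rewrite /uopp Eq -/(tpoly m _) comp_polyD linearD /= comp_polyM rmorphXn /=.
rewrite comp_polyX exprNn mulrA; set h := _ * _ * _.
have /eqP-> : tpoly m h == 0 by rewrite tpoly_eq0 dvdp_mull.
by rewrite addr0.
Qed.

Lemma tpoly_surj m (p : Rm m) : exists f, p = tpoly m f.
Proof. by exists p; rewrite tpolyK. Qed.

Lemma uopp_is_linear m : linear (@uopp R m).
Proof.
move=> a p q; have [[f ->] [g ->]] := (tpoly_surj p, tpoly_surj q).
by rewrite -linearP !uoppE comp_polyD comp_polyZ linearP.
Qed.
Lemma uopp_is_monoid m : monoid_morphism (@uopp R m).
Proof.
split=> [|p q]; first by rewrite -[1 in LHS](rmorph1 (@tpoly m)) uoppE !rmorph1.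
have [[f ->] [g ->]] := (tpoly_surj p, tpoly_surj q).
by rewrite -rmorphM !uoppE !rmorphM.
Qed.
HB.instance Definition _ m :=
  GRing.isLinear.Build C (Rm m) (Rm m) *:%R (@uopp R m) (@uopp_is_linear m).
HB.instance Definition _ m :=
  GRing.isMonoidMorphism.Build (Rm m) (Rm m) (@uopp R m) (@uopp_is_monoid m).

Lemma uoppK m : involutive (@uopp R m).
Proof.
move=> p; have [f ->] := tpoly_surj p; rewrite !uoppE -comp_polyA.
by rewrite raddfN /= comp_polyX opprK comp_polyXr.
Qed.

Lemma uoppD m (p q : Rm m) : uopp (p + q) = uopp p + uopp q.
Proof. exact: linearD. Qed.
Lemma uoppB m (p q : Rm m) : uopp (p - q) = uopp p - uopp q.
Proof. exact: linearB. Qed.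
Lemma uoppN m (p : Rm m) : uopp (- p) = - uopp p.
Proof. exact: linearN. Qed.
Lemma uoppZ m a (p : Rm m) : uopp (a *: p) = a *: uopp p.
Proof. exact: linearZ. Qed.

Lemma taylorD m f g z : taylor m (f + g) z = taylor m f z + taylor m g z.
Proof. by rewrite !taylorE !raddfD. Qed.
Lemma taylorB m f g z : taylor m (f - g) z = taylor m f z - taylor m g z.
Proof. by rewrite !taylorE !raddfB. Qed.
Lemma taylorZ m a f z : taylor m (a *: f) z = a *: taylor m f z.
Proof. by rewrite !taylorE !linearZ. Qed.
Lemma taylorM m f g z : taylor m (f * g) z = taylor m f z * taylor m g z.
Proof. by rewrite !taylorE !rmorphM. Qed.
Lemma taylor0 m z : taylor m 0 z = 0.
Proof. by rewrite !taylorE !raddf0. Qed.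
Lemma taylor_sum m z (I : Type) (r : seq I) (F : I -> {poly C}) :
  taylor m (\sum_(i <- r) F i) z = \sum_(i <- r) taylor m (F i) z.
Proof. by rewrite !taylorE !raddf_sum; apply: eq_bigr => i _; rewrite taylorE. Qed.

Lemma taylor_shift m f z t : taylor m (shift f t) z = taylor m f (z + t).
Proof.
rewrite !taylorE /shift -comp_polyA raddfD /= comp_polyX comp_polyC.
by rewrite polyCD addrA.
Qed.

Lemma taylor_oppX m f z : taylor m (f \Po (- 'X)) z = uopp (taylor m f (- z)).
Proof.
have N p : (- 'X : {poly C}) \Po p = - p by rewrite raddfN /= comp_polyX.
rewrite !taylorE uoppE -!comp_polyA N comp_polyD comp_polyX comp_polyC.
by rewrite polyCN opprD.
Qed.

(** Turns the congruences delivered by Hermite interpolation into equalities in R_m. *)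
Lemma taylor_dvd m f z : ('X - z%:P) ^+ m.+1 %| f -> taylor m f z = 0.
Proof.
case/dvdpP => q ->; rewrite taylorM [X in _ * X]taylorE rmorphXn.
rewrite [X in tpoly m (X ^+ _)](_ : _ = 'X); last first.
  by rewrite /= comp_polyB comp_polyX comp_polyC addrK.
have /eqP-> : tpoly m 'X^(m.+1) == 0 by rewrite tpoly_eq0.
by rewrite mulr0.
Qed.

Lemma taylor_shiftN m f z : taylor m (shift f (- z)) z = tpoly m f.
Proof. by rewrite taylor_shift subrr taylorE addr0 comp_polyXr. Qed.

End TruncatedPolynomials.

(** * Bands and the central extension *)

Section IntegerSums.

Definition irange (B : nat) : seq int :=
  [seq k%:Z - B%:Z | k <- iota 0 B.*2.+1].

Lemma irange_uniq B : uniq (irange B).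
Proof. by rewrite map_inj_uniq ?iota_uniq // => x y /addIr []. Qed.

Lemma mem_irange B k : (k \in irange B) = (`|k| <= B)%N.
Proof.
apply/mapP/idP => [[n + ->]|le_kB]; first by rewrite mem_iota; lia.
by exists (absz (k + B%:Z)); [rewrite mem_iota; lia | lia].
Qed.

Variable V : zmodType.
Implicit Types F G : int -> V.

Lemma fsum_irange B F : (forall k, (B < `|k|)%N -> F k = 0) ->
  \sum_(k \in [set: int]) F k = \sum_(k <- irange B) F k.
Proof.
move=> F0; rewrite (fsbig_seq _ _ (irange_uniq B)); apply/esym/fsbig_widen => //.
by move=> k [_ /= /negP]; rewrite mem_irange -ltnNge => /F0.
Qed.

Lemma fsum_single k0 F : (forall k, k != k0 -> F k = 0) ->
  \sum_(k \in [set: int]) F k = F k0.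
Proof.
move=> F0; transitivity (\sum_(k \in [set k0]) F k); last exact: fsbig_set1.
by apply/esym/fsbig_widen => // k [_ /= /eqP /F0].
Qed.

Lemma fsum_shift i F :
  \sum_(k \in [set: int]) F k = \sum_(k \in [set: int]) F (i + k).
Proof.
apply: (reindex_fsbigT (fun k => i + k)).
by exists (fun k => k - i) => k; [rewrite addrC addKr | rewrite addrC subrK].
Qed.

Lemma fsum_oppshift i F :
  \sum_(k \in [set: int]) F k = \sum_(k \in [set: int]) F (i - k).
Proof.
apply: (reindex_fsbigT (fun k => i - k)).
by exists (fun k => i - k) => k; rewrite subKr.
Qed.

Lemma finite_supp_bound F : finite_set [set k | F k <> 0] ->
  exists B, forall k, (B < `|k|)%N -> F k = 0.
Proof.
case/finite_seqP => ks eq_ks; exists (\max_(k <- ks) `|k|%N) => k lt_k.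
apply/eqP/negPn/negP => /eqP ak; have k_in : k \in ks.
  by have : [set k | F k <> 0] k by []; rewrite eq_ks.
have := @leq_bigmax_seq _ _ xpredT (fun k : int => `|k|%N) k k_in isT.
by rewrite leqNgt lt_k.
Qed.

End IntegerSums.

Section Bands.
Variable R : realType.
Local Notation C := R[i].
Local Notation Rm m := ({poly %/ ('X^(m.+1) : {poly R[i]})}).

(** Entries are indexed by their column, as in the sum of the f(s-j+u) E_{j-k,j}, so that t^k f(D)
    is sent to a [band k]. *)
Definition band m (k : int) (a : int -> Rm m) (z : Rm m) : glhat R m :=
  (fun i j => if j - i == k then a j else 0, z).

Lemma band_gl m k a z : @gl_inf R m (band k a z).
Proof.
by exists `|k|%N => i j lt_k; rewrite /band /=; case: eqP => // e; lia.
Qed.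

Lemma band_deg m k a : @glhat_deg R m k (band k a 0).
Proof. by split=> //= i j /eqP/negPf->. Qed.

Lemma band0_deg m a z : @glhat_deg R m 0 (band 0 a z).
Proof. by split=> //= i j /eqP/negPf->. Qed.

Lemma degE m k (x : glhat R m) :
  glhat_deg k x -> x = band k (fun j => x.1 (j - k) j) x.2.
Proof.
case: x => A z [/= A0 _]; congr (_, _).
apply/funext => i; apply/funext => j; case: eqP => [<-|/A0 //].
by rewrite opprB addrC subrK.
Qed.

Lemma bandP m k (a b : int -> Rm m) y z :
  band k a y = band k b z <-> a =1 b /\ y = z.
Proof.
split=> [[+ ->]|[/funext-> ->] //]; split=> // j.
have := congr1 (fun A : mat R m => A (j - k) j) H.
by rewrite opprB addrC subrK eqxx.
Qed.

Lemma bandD m k (a b : int -> Rm m) y z :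
  band k a y + band k b z = band k (fun j => a j + b j) (y + z).
Proof.
congr (_, _); apply/funext => i; apply/funext => j.
rewrite /band /= !fctE; case: ifP => // _; exact: addr0.
Qed.

Lemma bandZ m k c (a : int -> Rm m) y :
  c *: band k a y = band k (fun j => c *: a j) (c *: y).
Proof.
congr (_, _); apply/funext => i; apply/funext => j.
rewrite /band /= !fctE; case: ifP => // _; exact: scaler0.
Qed.

Lemma bandN m k (a : int -> Rm m) y :
  - band k a y = band k (fun j => - a j) (- y).
Proof.
congr (_, _); apply/funext => i; apply/funext => j.
rewrite /band /= !fctE; case: ifP => // _; exact: oppr0.
Qed.

Lemma band0 m k : band k (fun=> 0) 0 = 0 :> glhat R m.
Proof.
by congr (_, _); apply/funext => i; apply/funext => j; rewrite if_same.
Qed.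

Lemma band_sum m k (I : Type) (r : seq I) (a : I -> int -> Rm m) :
  \sum_(i <- r) band k (a i) 0 = band k (fun j => \sum_(i <- r) a i j) 0.
Proof.
elim: r => [|i r IHr].
  rewrite big_nil -[LHS](band0 m k); apply/bandP; split=> // j.
  by rewrite big_nil.
rewrite big_cons IHr bandD addr0; apply/bandP; split=> // j.
by rewrite big_cons.
Qed.

Lemma mat_mul_band m k l (a b : int -> Rm m) y z :
  mat_mul (band k a y).1 (band l b z).1 =
  (band (k + l) (fun j => a (j - l) * b j) 0).1.
Proof.
apply/funext => i; apply/funext => j; rewrite /mat_mul (@fsum_single _ (j - l)).
  rewrite /= (_ : j - (j - l) == l); last by lia.
  have -> : (j - l - i == k) = (j - i == k + l) by apply/eqP/eqP; lia.
  by case: ifP => // _; rewrite mul0r.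
move=> t /eqP ne; rewrite /= [X in _ * X]ifF ?mulr0 //.
by apply/negbTE/eqP; lia.
Qed.

Definition Jsign m (i : int) : Rm m := (i <= 0)%R%:R.

Lemma JmatE m : Jmat R m = (band 0 (Jsign m) 0).1.
Proof.
apply/funext => i; apply/funext => j; rewrite /Jmat /Jsign /=.
rewrite subr_eq0 eq_sym; case: eqP => [->|_] //.
Qed.

Lemma mat_br_band m k l (a b : int -> Rm m) y z :
  mat_br (band k a y).1 (band l b z).1 =
  (band (k + l) (fun j => a (j - l) * b j - b (j - k) * a j) 0).1.
Proof.
rewrite /mat_br !mat_mul_band [l + k]addrC.
apply/funext => i; apply/funext => j.
rewrite !fctE /band /=; case: ifP => // _; exact: subr0.
Qed.

(** This is Tr([J,A]B) for A of degree k, B of degree -k and c_i = A_{i,i+k} B_{i+k,i}; the sign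
    factor is nonzero for |k| indices only. *)
Definition cocycle m (k : int) (c : int -> Rm m) : Rm m :=
  \sum_(i \in [set: int]) (Jsign m i - Jsign m (i + k)) * c i.

Lemma cocycle_Posz m n (c : int -> Rm m) :
  cocycle n%:Z c = \sum_(1 <= t < n.+1) c (t%:Z - n%:Z).
Proof.
rewrite /cocycle (@fsum_shift _ (- n%:Z)) (@fsum_irange _ n) => [|k lt_nk].
  transitivity (\sum_(k <- irange n | 0 < k) c (k - n%:Z)).
    rewrite [RHS]big_mkcond big_seq [RHS]big_seq; apply: eq_bigr => k.
    rewrite mem_irange => kP; rewrite /Jsign [- _ + k]addrC subrK.
    rewrite (_ : k - _ <= 0); last by lia.
    case: ltrP => _; first by rewrite subr0 mul1r.
    by rewrite subrr mul0r.
  rewrite -big_filter /index_iota subSS subn0.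
  rewrite -[RHS](big_map (fun t : nat => t%:Z) xpredT (fun k => c (k - n%:Z))).
  apply: perm_big; apply: uniq_perm.
  - by rewrite filter_uniq // irange_uniq.
  - by rewrite map_inj_uniq ?iota_uniq // => ? ? [].
  move=> k; rewrite mem_filter mem_irange; apply/idP/mapP => [kP|[t + ->]].
    by exists (absz k); [rewrite mem_iota; lia | lia].
  by rewrite mem_iota; lia.
rewrite /Jsign [_ + k]addrC subrK.
have [k0|k0] := lerP k 0; first by rewrite (_ : _ <= 0) ?subrr ?mul0r //; lia.
by rewrite (_ : (_ <= 0) = false) ?subrr ?mul0r //; lia.
Qed.

Lemma cocycle_opp m k (c : int -> Rm m) :
  cocycle (- k) c = - cocycle k (fun i => c (i + k)).
Proof.
rewrite /cocycle (@fsum_shift _ k) (@fsum_irange _ `|k|) => [|i lt_ki].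
  rewrite [in RHS](@fsum_irange _ `|k|) => [|i lt_ki].
    rewrite -sumrN; apply: eq_bigr => i _.
    by rewrite [k + i]addrC addrK -mulNr opprB.
  by rewrite /Jsign (_ : (i <= 0) = (i + k <= 0)) ?subrr ?mul0r //; lia.
by rewrite /Jsign (_ : (k + i <= 0) = (k + i - k <= 0)) ?subrr ?mul0r //; lia.
Qed.

Lemma glhat_br_band m k l (a b : int -> Rm m) y z :
  glhat_br (band k a y) (band l b z) =
  band (k + l) (fun j => a (j - l) * b j - b (j - k) * a j)
    (if k + l == 0 then cocycle k (fun i => a (i + k) * b i) else 0).
Proof.
rewrite /glhat_br mat_br_band; congr (_, _).
rewrite JmatE mat_br_band mat_mul_band /mat_tr add0r.
have [kl|kl] := eqVneq (k + l) 0; last first.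
  by apply: fsbig1 => i _ /=; rewrite subrr eq_sym (negbTE kl).
have -> : l = - k by lia.
apply: eq_fsbigr => i _ /=; rewrite !subrr eqxx opprK addrK subr0.
by rewrite [X in _ - X]mulrC -mulrBl mulrA.
Qed.

End Bands.

(** * The homomorphism to the central extension *)

Section CentralCharge.
Variable R : realType.
Local Notation C := R[i].
Local Notation Rm m := ({poly %/ ('X^(m.+1) : {poly R[i]})}).
Implicit Types f g h P : {poly C}.

Lemma shift0 f : shift f 0 = f.
Proof. by rewrite /shift addr0 comp_polyXr. Qed.

Lemma shift_shift f a b : shift (shift f a) b = shift f (a + b).
Proof.
rewrite /shift -comp_polyA comp_polyD comp_polyX comp_polyC polyCD.
by rewrite [a%:P + _]addrC addrA.
Qed.

Lemma shiftM f g a : shift (f * g) a = shift f a * shift g a.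
Proof. exact: comp_polyM. Qed.

Lemma horner_shift f a b : (shift f a).[b] = f.[b + a].
Proof. by rewrite /shift horner_comp hornerD hornerX hornerC. Qed.

Lemma size_quo_expm1_seq (M : lmodType C) (F : nat -> M) n :
  size (quo_expm1_seq F n) = n.
Proof. by elim: n => //= n IHn; rewrite size_rcons IHn. Qed.

Lemma nth_quo_expm1_seq (M : lmodType C) (F : nat -> M) n k : (k < n)%N ->
  nth 0 (quo_expm1_seq F n) k = quo_expm1 F k.
Proof.
elim: n => // n IHn; rewrite ltnS leq_eqVlt => /predU1P[-> //|lt_kn].
by rewrite /= nth_rcons size_quo_expm1_seq lt_kn IHn.
Qed.

(** The left side is the coefficient of x^(n+1) in (e^x - 1) times the quotient. *)
Lemma quo_expm1P (M : lmodType C) (F : nat -> M) n :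
  \sum_(k < n.+1) ((n.+1 - k)`!)%:R^-1 *: quo_expm1 F k = F n.+1.
Proof.
rewrite big_ord_recr /= subSnn invr1 scale1r.
rewrite [X in _ + X]/quo_expm1 /= nth_rcons size_quo_expm1_seq ltnn eqxx.
rewrite addrC -[RHS]addr0 -addrA; congr (_ + _).
rewrite addrC; apply/eqP; rewrite subr_eq0; apply/eqP.
by apply: eq_bigr => k _; rewrite nth_quo_expm1_seq.
Qed.

Variables (m : nat) (s : C).
Local Notation Q := (quo_expm1 (center_num m s)).

Lemma phi_center_wide n f : (size f <= n)%N ->
  phi_center m s f = - \sum_(k < n) (f`_k * (k`!)%:R) *: Q k.
Proof.
move=> le_fn; congr (- _).
rewrite (big_ord_widen _ (fun k => (f`_k * (k`!)%:R) *: Q k) le_fn) big_mkcond.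
apply: eq_bigr => k _; case: ltnP => // le_fk.
by rewrite nth_default // mul0r scale0r.
Qed.

Lemma phi_center_is_linear : linear (phi_center m s).
Proof.
move=> a f g; pose n := maxn (size f) (size g).
have le_n : (size (a *: f + g)%R <= n)%N.
  by rewrite (leq_trans (size_polyD _ _)) // geq_max leq_maxr andbT
             (leq_trans (size_scale_leq _ _)) ?leq_maxl.
rewrite (phi_center_wide le_n) (phi_center_wide (leq_maxl _ _ : _ <= n)%N).
rewrite (phi_center_wide (leq_maxr _ _ : _ <= n)%N) scalerN -opprD scaler_sumr.
rewrite -big_split; congr (- _); apply: eq_bigr => k _.
by rewrite coefD coefZ mulrDl -mulrA scalerDl scalerA.
Qed.

HB.instance Definition _ :=
  GRing.isLinear.Build C {poly C} (Rm m) *:%R (phi_center m s)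
    phi_center_is_linear.

(** The series [center_num] is e^{(s+u)x} - 1, expanded in powers of u. *)
Lemma taylorXn n : taylor m 'X^(n.+1) s = (n.+1)`!%:R *: center_num m s n.+1.
Proof.
rewrite /taylor /center_num big_ord_recl /= hornerXn fact0 divr1 expr0.
rewrite scalerDr subr0 scalerA /exp_series.
have fact_neq0 k : k`!%:R != 0 :> C by rewrite pnatr_eq0 -lt0n fact_gt0.
rewrite [_ * (_ / _)]mulrC divfK //; congr (_ + _).
rewrite scaler_sumr [RHS]big_add1 /= big_mkord [RHS]big_mkcond.
apply: eq_bigr => i _; rewrite -derivnS add0n derivnXn hornerMn hornerXn /bump /= add1n.
case: ltnP => [le_in|lt_ni]; last by rewrite ffact_small // mulr0n mul0r scale0r.
rewrite scalerA; congr (_ *: _).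
rewrite -(ffact_fact le_in) natrM -mulr_natl subSS -!mulrA; congr (_ * _).
by rewrite !mulrA [_ * s ^+ _]mulrC mulfK.
Qed.

Lemma phi_center_Xn n : phi_center m s 'X^n = - (n`!%:R *: Q n).
Proof.
rewrite (phi_center_wide (n := n.+1)) ?size_polyXn // big_ord_recr /=.
rewrite big1 ?add0r ?coefXn ?eqxx ?mul1r // => k _.
by rewrite coefXn ltn_eqF // mul0r scale0r.
Qed.

(* The functional [phi_center] sends [e^((x+1) w) - e^(x w)], that is
   [(e^w - 1) e^(x w)], to minus the numerator [e^((s+u) w) - 1]. *)
Lemma phi_center_diff P :
  phi_center m s (shift P 1 - P) = (P.[0])%:A - taylor m P s.
Proof.
have Xn n : phi_center m s (shift 'X^n 1 - 'X^n) =
    ('X^n : {poly C}).[0]%:A - taylor m 'X^n s.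
  case: n => [|n].
    rewrite /shift comp_polyC subrr linear0 hornerC taylorE comp_polyC rmorph1.
    by rewrite scale1r subrr.
  rewrite taylorXn hornerXn expr0n scale0r add0r -quo_expm1P scaler_sumr.
  rewrite /shift rmorphXn /= comp_polyX exprD1n big_ord_recr /= binn addrK.
  rewrite linear_sum -sumrN; apply: eq_bigr => i _.
  rewrite linearMn /= phi_center_Xn mulNrn scalerA -scaler_nat scalerA -natrM.
  have le_in : (i <= n.+1)%N by rewrite ltnW.
  congr (- (_ *: _)); rewrite -(bin_fact le_in) !natrM !mulrA mulfK //.
  by rewrite pnatr_eq0 -lt0n fact_gt0.
rewrite -[P]coefK poly_def {1}/shift linear_sum -sumrB linear_sum.
rewrite horner_sum taylor_sum scaler_suml -sumrB; apply: eq_bigr => i _.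
rewrite [X in X - _]linearZ /= -scalerBr linearZ /= Xn hornerZ taylorZ.
by rewrite scalerBr scalerA.
Qed.

(** Telescopes [phi_center_diff] along P(D-1), ..., P(D-n). *)
Lemma phi_center_shiftB n P :
  phi_center m s (shift P (- n%:R) - P) =
  \sum_(1 <= t < n.+1) (taylor m P (s - t%:R) - (P.[- t%:R])%:A).
Proof.
rewrite big_add1 /=; elim: n => [|n IHn].
  by rewrite big_geq // oppr0 /shift addr0 comp_polyXr subrr linear0.
rewrite big_nat_recr //= -IHn.
have -> : shift P (- n.+1%:R) - P = (shift P (- n%:R) - P) -
    (shift (shift P (- n.+1%:R)) 1 - shift P (- n.+1%:R)).
  rewrite shift_shift -[n.+1%:R]natr1 opprD addrNK; ring.
rewrite linearB /= phi_center_diff opprB taylor_shift horner_shift add0r.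
by [].
Qed.

(** With P = f(D) g(D+r) the bracket is P(D-r) - P(D). For r >= 0 the telescoped sum is the cocycle
    minus the scalars P(-t), and these add up to Psi; r < 0 follows by exchanging f and g. *)
Lemma center_cocycle r f g :
  phi_center m s (shift f (- r)%:~R * g - f * shift g r%:~R) + (Psi r f g)%:A =
  cocycle r (fun i => taylor m f (s - (i + r)%:~R) * taylor m g (s - i%:~R)).
Proof.
have pos n f1 g1 : phi_center m s
    (shift f1 (- n%:R) * g1 - f1 * shift g1 n%:R) + (Psi_pos n f1 g1)%:A =
  cocycle n%:Z
    (fun i => taylor m f1 (s - (i + n%:Z)%:~R) * taylor m g1 (s - i%:~R)).
  have -> : shift f1 (- n%:R) * g1 - f1 * shift g1 n%:R =
            shift (f1 * shift g1 n%:R) (- n%:R) - f1 * shift g1 n%:R.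
    by rewrite shiftM shift_shift subrr shift0.
  rewrite phi_center_shiftB cocycle_Posz sumrB /Psi_pos scaler_suml.
  rewrite [X in _ - _ + X](_ : _ = \sum_(1 <= t < n.+1)
      ((f1 * shift g1 n%:R).[- t%:R])%:A) ?subrK; last first.
    by apply: eq_bigr => t _; rewrite hornerM horner_shift addrC.
  apply: eq_bigr => t _; rewrite taylorM taylor_shift.
  congr (taylor m f1 _ * taylor m g1 _); first by rewrite addrNK pmulrn.
    by rewrite rmorphB /= -!pmulrn; ring.
case: r => n.
  by have := pos n f g; rewrite rmorphN /= -pmulrn.
rewrite NegzE cocycle_opp /Psi.
have := pos n.+1 g f; rewrite opprK rmorphN /= -pmulrn => E.
rewrite scaleNr -[_ * g - _]opprB linearN /= -opprD.
rewrite [g * _]mulrC [shift g _ * _]mulrC in E.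
rewrite E; congr (- _); apply: eq_fsbigr => i _; rewrite addrK.
by congr (_ * _); rewrite mulrC.
Qed.

End CentralCharge.

Section Homomorphism.
Variable R : realType.
Local Notation C := R[i].

Lemma mat_br_Jmat m (A : mat R m) i j :
  mat_br (Jmat R m) A i j = (Jsign R m i - Jsign R m j) * A i j.
Proof.
rewrite /mat_br /mat_mul !fctE JmatE (@fsum_single _ i) => [|k ne].
  rewrite [X in _ - X](@fsum_single _ j) => [|k ne].
    by rewrite /= !subrr mulrBl [A i j * _]mulrC.
  by rewrite /= subr_eq0 eq_sym (negbTE ne) mulr0.
by rewrite /= subr_eq0 (negbTE ne) mul0r.
Qed.

Variables (m : nat) (s : C).

Lemma phihat_is_linear : linear (phihat m s).
Proof.
move=> a x y; rewrite /phihat; congr (_, _).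
  apply/funext => i; apply/funext => j; rewrite /phi !fctE /=.
  by rewrite taylorD taylorZ.
rewrite /= linearP /= scalerDr scalerDl scalerA.
by rewrite -!addrA; congr (_ + _); rewrite addrCA.
Qed.

Lemma Psi0 r (g : {poly C}) : Psi r 0 g = 0.
Proof.
by case: r => n; rewrite /Psi /Psi_pos big1 ?oppr0 // => i _;
  rewrite horner0 ?mul0r ?mulr0.
Qed.

Lemma phihat_br (x y : dhat R) : fin_supp x.1 -> fin_supp y.1 ->
  phihat m s (dhat_br x y) = glhat_br (phihat m s x) (phihat m s y).
Proof.
case: x y => [x cx] [y cy] /= /finite_supp_bound[Bx x0] /finite_supp_bound[By y0].
pose B := maxn Bx By.
have {}x0 k : (B < `|k|)%N -> x k = 0 by rewrite gtn_max => /andP[/x0].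
have {}y0 k : (B < `|k|)%N -> y k = 0 by rewrite gtn_max => /andP[_ /y0].
have shiftx0 k t : (B < `|k|)%N -> shift (x k) t = 0.
  by move/x0->; rewrite /shift comp_poly0.
have dE n : (dhat_br (x, cx) (y, cy)).1 n = \sum_(r <- irange B)
    (shift (x r) (n - r)%:~R * y (n - r) - x r * shift (y (n - r)) r%:~R).
  rewrite /= (@fsum_irange _ B) // => k lt_k.
  by rewrite shiftx0 // x0 // !mul0r subrr.
rewrite /phihat /glhat_br; congr (_, _); last first.
  rewrite dE linear_sum /= (@fsum_irange _ B) => [|k lt_k]; last first.
    by rewrite x0 // Psi0.
  rewrite scaler_suml -big_split /=.
  under eq_bigr => r _ do rewrite sub0r center_cocycle.
  rewrite /mat_tr /mat_mul.
  have inner i : \sum_(k \in [set: int])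
      mat_br (Jmat R m) (phi m s x) i k * phi m s y k i =
    \sum_(r <- irange B) (Jsign R m i - Jsign R m (i + r)) *
      (taylor m (x r) (s - (i + r)%:~R) * taylor m (y (- r)) (s - i%:~R)).
    rewrite (@fsum_shift _ i) (@fsum_irange _ B) => [|k lt_k].
      apply: eq_bigr => r _; rewrite mat_br_Jmat /phi addrAC subrr add0r.
      by rewrite opprD addNKr mulrA.
    by rewrite mat_br_Jmat /phi addrAC subrr add0r x0 // taylor0 mulr0 mul0r.
  under eq_fsbigr => i _ do rewrite inner.
  have J0 i r : (B < `|i|)%N -> (`|r| <= B)%N ->
      Jsign R m i - Jsign R m (i + r) = 0.
    by move=> lt_i le_r; rewrite /Jsign (_ : (i <= 0) = (i + r <= 0)) ?subrr //; lia.
  rewrite (@fsum_irange _ B) => [|i lt_i]; last first.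
    rewrite big_seq big1 // => r; rewrite mem_irange => le_r.
    by rewrite J0 // mul0r.
  rewrite exchange_big /= big_seq [RHS]big_seq; apply: eq_bigr => r.
  rewrite mem_irange => le_r; rewrite /cocycle (@fsum_irange _ B) // => i lt_i.
  by rewrite J0 // mul0r.
apply/funext => i; apply/funext => j.
rewrite /mat_br /mat_mul !fctE /phi dE taylor_sum /=.
rewrite (@fsum_shift _ i) (@fsum_irange _ B) => [|k lt_k]; last first.
  by rewrite addrAC subrr add0r x0 // taylor0 mul0r.
(* After this reindexing r is the degree of the [x] factor in both products. *)
rewrite [X in _ = _ - X](@fsum_oppshift _ j).
rewrite [X in _ = _ - X](@fsum_irange _ B) => [|k lt_k]; last first.
  by rewrite subKr x0 // taylor0 mulr0.
rewrite -sumrB; apply: eq_bigr => r _.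
rewrite taylorB !taylorM !taylor_shift.
rewrite [i + r - i]addrAC subrr add0r subKr.
have e1 : s - j%:~R + (j - i - r)%:~R = s - (i + r)%:~R.
  by rewrite !rmorphB rmorphD /=; ring.
have e2 : s - j%:~R + r%:~R = s - (j - r)%:~R by rewrite rmorphB /=; ring.
have -> : j - (i + r) = j - i - r by lia.
have -> : j - r - i = j - i - r by lia.
by rewrite e1 e2; congr (_ - _); rewrite mulrC.
Qed.

End Homomorphism.

(** * Difference equations on the integers *)

Section DifferenceEquation.
Variable V : zmodType.

(* The solution is [d j = sum_i ([i <= 0] - [i <= j]) q i] over the [i] congruent
   to [j] modulo [k]. *)
Lemma difference_solvable_pos (k : int) (q : int -> V) : 0 < k ->
  exists d : int -> V, forall j, d (j - k) - d j = q j.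
Proof.
move=> k0; pose c (j i : int) : int := ((i <= 0)%R%:Z - (i <= j)%R%:Z).
pose d j := \sum_(i <- irange (absz j) | (k %| i - j)%Z) q i *~ c j i.
have dE B j : (`|j| <= B)%N ->
    d j = \sum_(i <- irange B) if (k %| i - j)%Z then q i *~ c j i else 0.
  move=> le_jB; rewrite /d big_mkcond -!fsum_irange // => i lt_i;
    case: ifP => // _; rewrite /c (_ : (i <= 0) = (i <= j)) ?subrr ?mulr0z //; lia.
exists d => j; pose B := (absz j + absz k)%N.
rewrite !(dE B) -?sumrB; try by rewrite /B; lia.
transitivity (\sum_(i \in [set: int]) if i == j then q i else 0); last first.
  by rewrite (@fsum_single _ j) ?eqxx // => i /negbTE->.
rewrite (@fsum_irange _ B) => [|i lt_i]; last first.
  by case: eqP => // e; move: lt_i; rewrite /B; lia.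
apply: eq_bigr => i _.
have -> : (k %| i - (j - k))%Z = (k %| i - j)%Z.
  by rewrite opprB addrA addrAC rpredDr ?dvdzz.
have [d_ij|nd] := boolP (k %| i - j)%Z; last first.
  by rewrite subrr; case: eqP nd => // ->; rewrite subrr dvdz0.
have [->|ne] := eqVneq i j.
  by rewrite -mulrzBr (_ : c (j - k) j - c j j = 1) ?mulr1z // /c; lia.
rewrite -mulrzBr (_ : c (j - k) i - c j i = 0) ?mulr0z //.
(* No i <> j congruent to j modulo k satisfies j - k < i <= j, so both coefficients agree. *)
have /dvdzP[t Et] := d_ij; have t0 : t != 0.
  by apply: contraNneq ne => t0; rewrite -subr_eq0 Et t0 mul0r.
rewrite /c; have : (i <= j) = (i <= j - k); last by move=> ->; rewrite subrr.
have [t_gt0|t_le0] := ltrP 0 t.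
  have : k <= t * k by nia.
  by lia.
have : t * k <= - k by nia.
by lia.
Qed.

Lemma difference_solvable (k : int) (q : int -> V) : k != 0 ->
  exists d : int -> V, forall j, d (j - k) - d j = q j.
Proof.
case: (ltrgtP k 0) => // k0 _; last exact: difference_solvable_pos.
have k'0 : 0 < - k by lia.
have [d dE] := difference_solvable_pos (fun j => q (j + k)) k'0.
exists (fun j => - d j) => j; rewrite opprK -[in q j](subrK k j) -dE.
by rewrite (opprK k) subrK addrC.
Qed.

End DifferenceEquation.

(** * Bands fixed by an anti-involution *)

Section SymmetricBands.
Variable R : realType.
Local Notation C := R[i].
Local Notation Rm m := ({poly %/ ('X^(m.+1) : {poly R[i]})}).

Variables (m : nat) (b : bool) (eps : int) (eta : int -> C).
Hypothesis etaM : forall k l, eta k * eta l = - eta (k + l).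
Hypothesis eta_sq : forall k, eta k * eta k = 1.

Let eta0 : eta 0 = -1.
Proof. by have := etaM 0 0; rewrite addr0 eta_sq => ->; rewrite opprK. Qed.
(* The matrices fixed by the anti-involution, when [b] holds; all matrices with
   finitely many diagonals otherwise. *)
Definition symg : set (glhat R m) :=
  [set x | gl_inf x /\
    (b -> forall i j, x.1 i j = eta (j - i) *: uopp (x.1 (eps - j) (eps - i)))].

Implicit Types a q : int -> Rm m.

Definition symseq k a := b -> forall j, a j = eta k *: uopp (a (eps + k - j)).
(** These multipliers preserve [symseq k] under the entrywise product, and differences d(j-k) - d(j)
    of sequences in [symseq 0] are of this kind. *)
Definition invseq k q := b -> forall j, q j = uopp (q (eps + k - j)).

Lemma symg_band k a z : symseq k a -> symg (band k a z).
Proof.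
move=> sa; split; first exact: band_gl.
move=> hb i j; rewrite /band /=.
rewrite (_ : eps - i - (eps - j) = j - i); last by lia.
case: eqP => [e|_]; last by rewrite linear0 scaler0.
by rewrite {1}(sa hb) -e; congr (_ *: uopp (a _)); lia.
Qed.

Lemma symg_seq k (x : glhat R m) : symg x -> symseq k (fun j => x.1 (j - k) j).
Proof.
case=> _ sx hb j; rewrite sx // subKr; congr (eta _ *: uopp (x.1 _ _)); lia.
Qed.

Lemma symg_band_seq k a z : symg (band k a z) -> symseq k a.
Proof.
move=> /(symg_seq k) sa hb j; have := sa hb j; rewrite /band /=.
have e i : i - (i - k) == k by lia.
by rewrite !e.
Qed.

Lemma symseqD k a a' : symseq k a -> symseq k a' -> symseq k (fun j => a j + a' j).
Proof. by move=> sa sa' hb j /=; rewrite linearD scalerDr -sa // -sa'. Qed.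

Lemma symseqZ k c a : symseq k a -> symseq k (fun j => c *: a j).
Proof. by move=> sa hb j /=; rewrite linearZ /= scalerA mulrC -scalerA -sa. Qed.

(* Averaging a solution over the anti-involution. *)
Lemma symseq_difference k q : k != 0 -> invseq k q ->
  exists2 d, symseq 0 d & forall j, d (j - k) - d j = q j.
Proof.
move=> k0 sq; have [d dE] := difference_solvable q k0.
case: (boolP b) => hb; last by exists d; rewrite // /symseq (negbTE hb).
pose h : C := 2^-1.
exists (fun j => h *: (d j - uopp (d (eps - j)))) => [_ j|j].
  rewrite eta0 scaleN1r addr0 subKr linearZ /= -scalerN; congr (_ *: _).
  by rewrite linearB /= uoppK opprB.
transitivity (h *: ((d (j - k) - d j) + uopp (d (eps - j) - d (eps - (j - k))))).
  rewrite -[LHS]scalerBr; congr (_ *: _).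
  rewrite [X in _ = _ + X]linearB /= [X in _ + X]opprB.
  by rewrite addrACA [RHS]addrACA; congr (_ + _); exact: addrC.
have -> : eps - (j - k) = eps + k - j by lia.
have -> : eps - j = eps + k - j - k by lia.
rewrite !dE -sq // -[q j + _]mulr2n -scaler_nat.
by rewrite scalerA mulVf ?scale1r // pnatr_eq0.
Qed.

End SymmetricBands.

(** * Smooth modules *)

Lemma linear_at0 (K : pzRingType) (U V : lmodType K) (f : U -> V) :
  linear f -> f 0 = 0.
Proof.
move=> f_lin; have := f_lin 1 0 0; rewrite scaler0 addr0 scale1r => /eqP.
by rewrite -subr_eq subrr eq_sym => /eqP.
Qed.

Lemma scalar_at0 (K : pzRingType) (U : lmodType K) (f : U -> K) :
  scalar f -> f 0 = 0.
Proof. exact: (@linear_at0 K U K^o). Qed.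

Section LieModuleFacts.
Variables (K : fieldType) (L V : lmodType K).
Variables (g : set L) (br : L -> L -> L) (act : L -> V -> V).
Hypotheses (gS : subspace g) (Hact : lie_module g br act).

Let act_lin x : g x -> linear (act x). Proof. by case: Hact => + _ _; apply. Qed.
Let act_linl v a x y : g x -> g y -> act (a *: x + y) v = a *: act x v + act y v.
Proof. by case: Hact => _ + _; apply. Qed.

Lemma subspaceD x y : g x -> g y -> g (x + y).
Proof. by move=> gx gy; rewrite -[x]scale1r; apply: (proj2 gS). Qed.
Lemma subspaceZ a x : g x -> g (a *: x).
Proof. by move=> gx; rewrite -[_ *: _]addr0; apply: (proj2 gS) => //; case: gS. Qed.
Lemma subspace_sum (I : Type) (r : seq I) (P : pred I) (F : I -> L) :
  (forall i, P i -> g (F i)) -> g (\sum_(i <- r | P i) F i).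
Proof. by move=> gF; elim/big_ind: _ => //; [case: gS | exact: subspaceD]. Qed.

Lemma act0v v : act 0 v = 0.
Proof.
have g0 : g 0 by case: gS.
have := act_linl v 1 g0 g0; rewrite scaler0 addr0 scale1r => /eqP.
by rewrite -subr_eq subrr eq_sym => /eqP.
Qed.
Lemma actDv v x y : g x -> g y -> act (x + y) v = act x v + act y v.
Proof. by move=> gx gy; rewrite -[x in LHS]scale1r act_linl // scale1r. Qed.
Lemma actZv v a x : g x -> act (a *: x) v = a *: act x v.
Proof.
by move=> gx; rewrite -[_ *: x]addr0 act_linl ?act0v ?addr0 //; case: gS.
Qed.
Lemma act_sumv v (I : Type) (r : seq I) (F : I -> L) : (forall i, g (F i)) ->
  act (\sum_(i <- r) F i) v = \sum_(i <- r) act (F i) v.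
Proof.
move=> gF; elim: r => [|i r IHr]; first by rewrite !big_nil act0v.
by rewrite !big_cons actDv ?IHr //; exact: subspace_sum.
Qed.

Lemma actr0 x : g x -> act x 0 = 0.
Proof. by move=> gx; apply: linear_at0; exact: act_lin. Qed.
Lemma actD x v w : g x -> act x (v + w) = act x v + act x w.
Proof. by move=> gx; rewrite -[v in LHS]scale1r act_lin // scale1r. Qed.
Lemma actZ x a v : g x -> act x (a *: v) = a *: act x v.
Proof. by move=> gx; rewrite -[_ *: v]addr0 act_lin // actr0 // addr0. Qed.
Lemma act_sum x (I : Type) (r : seq I) (F : I -> V) : g x ->
  act x (\sum_(i <- r) F i) = \sum_(i <- r) act x (F i).
Proof.
move=> gx; elim: r => [|i r IHr]; first by rewrite !big_nil actr0.
by rewrite !big_cons actD ?IHr.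
Qed.
End LieModuleFacts.

Lemma int_root_bound (R : realType) (p : {poly R[i]}) : p != 0 ->
  exists B : nat, forall j : int, (B < `|j|)%N -> p.[j%:~R] != 0.
Proof.
move=> p0; have [rs Ep] := closed_field_poly_normal p.
have lc0 : lead_coef p != 0 by rewrite lead_coef_eq0.
suff [B HB] : exists B : nat, forall j : int, (B < `|j|)%N -> j%:~R \notin rs.
  exists B => j /HB; apply: contra; rewrite -rootE Ep rootZ // root_prod_XsubC.
  by [].
elim: rs {Ep} => [|r rs [B HB]]; first by exists 0%N.
have [[k ->]|nr] := pselect (is_integer r); last first.
  exists B => j /HB nj; rewrite inE negb_or nj andbT.
  by apply/eqP => e; apply: nr; exists j.
exists (B + `|k|)%N => j lt_j; rewrite inE negb_or HB ?andbT; last by lia.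
by apply/eqP => /intr_inj e; rewrite e in lt_j; lia.
Qed.

Section SmoothModules.
Variable R : realType.
Local Notation C := R[i].
Local Notation Rm m := ({poly %/ ('X^(m.+1) : {poly R[i]})}).

Variables (m : nat) (b : bool) (eps : int) (eta : int -> C).
Hypothesis etaM : forall k l, eta k * eta l = - eta (k + l).
Hypothesis eta_sq : forall k, eta k * eta k = 1.
Local Notation symg := (@symg R m b eps eta).
Local Notation symseq := (symseq b eps eta).
Local Notation invseq := (invseq b eps).
Implicit Types (a q d E : int -> Rm m).

Lemma symg_subspace : subspace symg.
Proof.
split=> [|c x y [[Bx x0] sx] [[By y0] sy]].
  split; first by exists 0%N.
  have z0 i j : (0 : glhat R m).1 i j = 0 by [].
  by move=> _ i j; rewrite !z0 linear0 scaler0.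
split.
  exists (maxn Bx By) => i j; rewrite gtn_max => /andP[/x0 e /y0 e'].
  by rewrite /= !fctE e e' scaler0 addr0.
move=> hb i j; rewrite /= !fctE sx // sy // linearP /= scalerDr !scalerA.
by rewrite mulrC.
Qed.

Variables (V : lmodType C) (act : glhat R m -> V -> V).

(* [V] is smooth when, on every vector, the action of a matrix of nonzero degree
   depends on finitely many of its entries only. *)
Definition smooth : Prop := forall (v : V) (k : int), k != 0 ->
  exists B : nat, forall a, symseq k a -> (forall j, (`|j| <= B)%N -> a j = 0) ->
    act (band k a 0) v = 0.

Hypothesis Hact : lie_module symg (@glhat_br R m) act.

(* The annihilator of a subspace stable in degree [0] is an ideal for the
   entrywise product, because every sequence of factors is a difference. *)
Lemma annihilator_ideal (U : set V) k E :
    k != 0 -> symseq k E ->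
    (forall d, symseq 0 d -> forall w, U w -> U (act (band 0 d 0) w)) ->
    (forall w, U w -> act (band k E 0) w = 0) ->
  forall q, invseq k q -> forall w, U w -> act (band k (fun j => q j * E j) 0) w = 0.
Proof.
move=> k0 sE Ustab UE q sq w Uw.
have [d sd dE] := symseq_difference etaM eta_sq k0 sq.
have -> : band k (fun j => q j * E j) 0 = glhat_br (band 0 d 0) (band k E 0).
  rewrite glhat_br_band add0r (negbTE k0); apply/bandP; split=> // j.
  by rewrite subr0 [E j * _]mulrC -mulrBl dE.
case: Hact => _ _ -> //; last 2 first.
- exact: symg_band.
- exact: symg_band.
by rewrite UE ?UE ?(actr0 Hact) ?subr0 //; [exact: symg_band | exact: Ustab].
Qed.

(** Twice the signed distance from j to the centre of the reflection j -> eps + k - j. Its square is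
    invariant and [sgnw k] picks up the factor [eta k], so every polynomial p yields a symmetric
    sequence [weight k p]. *)
Let cen k (j : int) : C := (eps + k - j - j)%:~R.
Let sgnw k (j : int) : C := if eta k == 1 then 1 else cen k j.

Let cenN k j : cen k (eps + k - j) = - cen k j.
Proof. by rewrite /cen -mulrNz; congr (_%:~R); lia. Qed.

Let sgnwN k j : sgnw k (eps + k - j) = eta k * sgnw k j.
Proof.
rewrite /sgnw; have /eqP := eta_sq k; rewrite -expr2 sqrf_eq1 => /orP[] /eqP->.
  by rewrite eqxx mulr1.
rewrite (_ : (_ == _) = false) ?cenN ?mulN1r //.
by rewrite eq_sym -addr_eq0 -mulr2n pnatr_eq0.
Qed.

Let weight k (p : {poly C}) : int -> Rm m :=
  fun j => (p.[cen k j ^+ 2] * sgnw k j)%:A.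

Let weight_sym k p : symseq k (weight k p).
Proof.
move=> _ j; rewrite /weight linearZ rmorph1 cenN sqrrN sgnwN scalerA.
by congr (_ *: _); rewrite [RHS]mulrCA [eta k * (eta k * _)]mulrA eta_sq mul1r.
Qed.

(* Finite dimension gives a linear relation between the [band k (weight k 'X^n)]
   on [U]. *)
Lemma annihilator_nonzero (U U' : set V) k : finite_dimensional U ->
    finite_dimensional U' ->
    (forall a w, symseq k a -> U w -> U' (act (band k a 0) w)) ->
  exists2 p, p != 0 & forall w, U w -> act (band k (weight k p) 0) w = 0.
Proof.
move=> [n [e [Ue spanU]]] [n' [e' [U'e' spanU']]] UU'.
pose A (t : nat) := band k (weight k 'X^t) 0.
have gA t : symg (A t) by apply: symg_band; exact: weight_sym.
have /choice[c cP] : forall tl : nat * 'I_n, exists c : 'rV[C]_n',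
    act (A tl.1) (e tl.2) = \sum_(t < n') c 0 t *: e' t.
  move=> [t l]; have [|c ->] := spanU' (act (A t) (e l)).
    by apply: UU' => //; exact: weight_sym.
  by exists (\row_i c i); apply: eq_bigr => i _; rewrite mxE.
(* One row more than the n n' coordinates of a linear map on U, which forces a nonzero left
   kernel. *)
pose M : 'M[C]_((n * n').+1, n * n') :=
  \matrix_(t < (n * n').+1) mxvec (\matrix_(l < n) c (val t, l)).
have : kermx M != 0.
  rewrite kermx_eq0 -row_leq_rank -ltnNge ltnS; exact: rank_leq_col.
case/rowV0Pn => u /sub_kermxP uM u0.
pose p := \poly_(t < (n * n').+1) u 0 (inord t).
have p_coef (t : 'I_(n * n').+1) : p`_t = u 0 t.
  by rewrite coef_poly ltn_ord inord_val.
exists p.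
  apply: contraNneq u0 => p0; apply/eqP/rowP => t.
  by rewrite -p_coef p0 coef0 mxE.
have pE : band k (weight k p) 0 = \sum_(t < (n * n').+1) u 0 t *: A t.
  under eq_bigr do rewrite bandZ scaler0.
  rewrite band_sum; apply/bandP; split=> // j.
  rewrite /weight /p horner_poly mulr_suml scaler_suml.
  by apply: eq_bigr => t _; rewrite hornerXn scalerA mulrA inord_val.
have kill l : act (band k (weight k p) 0) (e l) = 0.
  rewrite pE (act_sumv symg_subspace Hact) => [|t]; last first.
    by apply: (subspaceZ symg_subspace); exact: gA.
  under eq_bigr => t _.
    rewrite (actZv symg_subspace Hact) // (cP (val t, l)) scaler_sumr.
    under eq_bigr do rewrite scalerA.
    over.
  rewrite exchange_big big1 //= => i _; rewrite -scaler_suml.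
  have /(congr1 (fun N : 'rV[C]_(n * n') => vec_mx N l i)) := uM.
  rewrite linear0 mxE [RHS]mxE => E.
  rewrite [X in X *: _](_ : _ = 0) ?scale0r // -[RHS]E !mxE.
  by apply: eq_bigr => t _; rewrite !mxE mxvecE !mxE.
move=> w /spanU[x ->]; rewrite (act_sum Hact).
  rewrite big1 // => l _; rewrite (actZ Hact) ?kill ?scaler0 //.
  by apply: symg_band; exact: weight_sym.
by apply: symg_band; exact: weight_sym.
Qed.

Let weight_bound k p : p != 0 -> exists B : nat, forall j : int, (B < `|j|)%N ->
  p.[cen k j ^+ 2] * sgnw k j != 0.
Proof.
(* The extra factor 'X takes care of [sgnw], which is either 1 or [cen]. *)
move=> p0; have P0 : (p \Po 'X^2) * 'X != 0.
  by rewrite mulf_neq0 ?polyX_eq0 // comp_poly_eq0 ?size_polyXn.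
have [B HB] := int_root_bound P0.
exists (B + absz eps + absz k)%N => j lt_j.
have : (B < `|(eps + k - j - j)%R|)%N by lia.
move/HB; rewrite -/(cen k j) hornerM horner_comp hornerXn hornerX mulf_eq0 negb_or.
case/andP => pz cz; rewrite mulf_neq0 // /sgnw.
by case: ifP => _; [exact: oner_neq0 | exact: cz].
Qed.

Lemma quasifinite_smooth :
  (exists Vd, graded_module symg (@glhat_deg R m) act Vd /\
     forall j, finite_dimensional (Vd j)) -> smooth.
Proof.
case=> Vd [[[Vsub Vdec] Vdeg] Vfin] v k k0.
have [w [[w_fin wV ->] _]] := Vdec v.
have [Bw w0] := finite_supp_bound w_fin.
have homog j0 : exists B : nat, forall a, symseq k a ->
    (forall j, (`|j| <= B)%N -> a j = 0) -> forall u, Vd j0 u -> act (band k a 0) u = 0.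
  have [||a u sa Vu|p p0 pV] := @annihilator_nonzero (Vd j0) (Vd (j0 - k)) k.
  - exact: Vfin.
  - exact: Vfin.
  - by apply: Vdeg Vu; [exact: symg_band | exact: band_deg].
  have [B HB] := weight_bound k p0; exists B => a sa a0 u Vu.
  (* [x j] can vanish only where [a j = 0], so the multiplier [(x j)^-1 *: a j] exhibits [a] in the
     ideal generated by the weight. *)
  pose x j := p.[cen k j ^+ 2] * sgnw k j.
  have -> : band k a 0 = band k (fun j => ((x j)^-1 *: a j) * weight k p j) 0.
    apply/bandP; split=> // j; rewrite /weight -scalerAr mulr1 scalerA -/(x j).
    have [/a0->|/HB xj] := leqP `|j| B; first by rewrite scaler0.
    by rewrite mulrC mulVf // scale1r.
  apply: (annihilator_ideal k0 (@weight_sym k p) _ pV) Vu => [d sd u' Vu'|].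
    rewrite -[j0]subr0; apply: Vdeg Vu'; [exact: symg_band | exact: band0_deg].
  move=> hb j; rewrite linearZ /= {1}(sa hb) scalerA /x cenN sqrrN sgnwN; congr (_ *: _).
  have eta0 : eta k != 0.
    by apply: contraTneq (oner_neq0 C) => e; rewrite -(eta_sq k) e mul0r eqxx.
  have etaV : (eta k)^-1 = eta k by rewrite -[LHS]mulr1 -(eta_sq k) mulKf.
  by rewrite [in RHS]mulrCA [RHS]invfM etaV mulrC.
have /choice[B HB] := homog.
exists (\max_(j <- irange Bw) B j) => a sa a0.
rewrite (@fsum_irange _ Bw) // (act_sum Hact); last exact: symg_band.
rewrite big_seq big1 // => j j_in; apply: (HB j) => // i le_i; apply: a0.
exact: (leq_trans le_i (@leq_bigmax_seq _ _ xpredT B j j_in isT)).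
Qed.
End SmoothModules.

(** * Degree 0 through brackets *)

Section DegreeZero.
Variable R : realType.
Local Notation C := R[i].
Local Notation Rm m := ({poly %/ ('X^(m.+1) : {poly R[i]})}).

Variables (m : nat) (b : bool) (eps : int) (eta : int -> C).
Hypothesis etaM : forall k l, eta k * eta l = - eta (k + l).
Hypothesis eta_sq : forall k, eta k * eta k = 1.
Local Notation symseq := (symseq b eps eta).

(* In degree [r = eps + 1] the anti-involution has no fixed diagonal entry, so that
   the products [a (i + r) * a' i] below are constrained by [c i = c (-1-i)] only.
   A constant sequence of products yields the central elements. *)
Lemma degree0_bracket (d : int -> Rm m) z : 0 <= eps -> symseq 0 d ->
  exists (r : int) (a a' : int -> Rm m) (z' : Rm m),
    [/\ r != 0, symseq r a, symseq (- r) a',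
        band 0 d z = glhat_br (band r a 0) (band (- r) a' 0) + band 0 (fun=> 0) z'
      & if b then uopp z' = - z' else z' = 0].
Proof.
move=> eps0 sd; have [n En] : exists n : nat, eps = n%:Z by exists (absz eps); lia.
pose r : int := n.+1.
pose h : C := 2^-1.
have half (x : Rm m) : h *: (x + x) = x.
  by rewrite -mulr2n -scaler_nat scalerA mulVf ?scale1r // pnatr_eq0.
have eta0 : eta 0 = -1.
  by have := etaM 0 0; rewrite addr0 eta_sq => ->; rewrite opprK.
have [c cd cS] : exists2 c : int -> Rm m, forall j, c j - c (j - r) = d j &
    b -> forall j, c j = uopp (c (-1 - j)).
  have [c cd] := @difference_solvable _ r (fun j => - d j) isT.
  have {}cd j : c j - c (j - r) = d j by rewrite -[RHS]opprK -cd opprB.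
  case: (boolP b) => hb; last by exists c => // j.
  exists (fun j => h *: (c j + uopp (c (-1 - j)))) => [j|_ j]; last first.
    by rewrite uoppZ uoppD uoppK subKr addrC.
  rewrite -scalerBr opprD addrACA cd -uoppB.
  have -> : -1 - (j - r) = eps - j by lia.
  have -> : -1 - j = eps - j - r by lia.
  rewrite -[_ - c (eps - j)]opprB cd uoppN.
  have -> : uopp (d (eps - j)) = - d j.
    by rewrite (sd hb j) eta0 scaleN1r addr0 opprK.
  by rewrite opprK half.
(* The reflection j -> -1 - j exchanges the two halves of Z, so [sgn] picks up [eta r] under it; as
   its square is 1, it disappears from the products. *)
pose sgn (j : int) : C := if 0 <= j then 1 else eta r.
have sgn_sq j : sgn j * sgn j = 1.
  by rewrite /sgn; case: ifP => _; rewrite ?mulr1.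
have sgnN j : sgn (-1 - j) = eta r * sgn j.
  rewrite /sgn (_ : (0 <= -1 - j) = ~~ (0 <= j)); last by lia.
  by case: (0 <= j) => /=; rewrite ?mulr1 ?eta_sq.
have etaN : eta (- r) = eta r.
  have := etaM r (- r); rewrite subrr eta0 opprK => E.
  by rewrite -[RHS]mulr1 -E mulrA eta_sq mul1r.
have decomp (c' : int -> Rm m) : (forall j, c' j - c' (j - r) = d j) ->
    (b -> forall j, c' j = uopp (c' (-1 - j))) ->
  exists a a' : int -> Rm m, [/\ symseq r a, symseq (- r) a' &
    band 0 d (cocycle r c') = glhat_br (band r a 0) (band (- r) a' 0)].
  move=> cd' cS'; exists (fun j => sgn (j - r) *: c' (j - r)), (fun j => (sgn j)%:A).
  split=> [hb j|hb j|].
  - rewrite /= uoppZ scalerA.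
    have -> : eps + r - j - r = -1 - (j - r) by lia.
    by rewrite -cS' // sgnN mulrA eta_sq mul1r.
  - rewrite /= uoppZ rmorph1 scalerA etaN.
    have -> : eps - r - j = -1 - j by lia.
    by rewrite sgnN mulrA eta_sq mul1r.
  rewrite glhat_br_band subrr eqxx; apply/bandP; split=> [j|].
    rewrite opprK addrK -!scalerAl -!scalerAr !mulr1 mul1r !scalerA.
    by rewrite !sgn_sq !scale1r cd'.
  rewrite /cocycle; apply: eq_fsbigr => i _; congr (_ * _).
  by rewrite addrK -scalerAl -scalerAr mulr1 scalerA sgn_sq scale1r.
have constant x : uopp x = x \/ ~~ b -> exists a a' : int -> Rm m,
  [/\ symseq r a, symseq (- r) a' &
    band 0 d (cocycle r c + x *+ n.+1) = glhat_br (band r a 0) (band (- r) a' 0)].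
  move=> x_even; have [||a [a' [sa sa' E]]] := decomp (fun j => c j + x).
  - by move=> j; rewrite opprD addrACA subrr addr0 cd.
  - move=> hb j; rewrite uoppD -cS //; case: x_even => [->//|].
    by rewrite hb.
  exists a, a'; split=> //; rewrite -E; apply/bandP; split=> //.
  rewrite !cocycle_Posz big_split /=; congr (_ + _).
  by rewrite big_const_nat subSS subn0 iter_addr addr0.
(* [y] is the central part still missing. Adding a constant to [c] keeps its differences and changes
   the cocycle by r = n + 1 copies of the constant, hence the division; under the symmetry only the
   even part [x] of [y] can be reached. *)
pose y := z - cocycle r c.
pose x := if b then h *: (y + uopp y) else y.
have xn : (n.+1%:R^-1 *: x) *+ n.+1 = x.
  by rewrite -scaler_nat scalerA mulfV ?scale1r // pnatr_eq0.
have [|a [a' [sa sa' E]]] := constant (n.+1%:R^-1 *: x).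
  rewrite uoppZ /x; case: ifP => hb; last by right.
  by left; rewrite uoppZ uoppD uoppK addrC.
exists r, a, a', (y - x); split=> //.
  rewrite -E xn bandD; apply/bandP; split=> [j|]; first by rewrite addr0.
  by rewrite /y addrACA subrr addr0 addrC subrK.
rewrite /x; case: b => /=; last by rewrite subrr.
rewrite uoppB uoppZ uoppD uoppK opprB [y + _]addrC; apply/eqP.
by rewrite -subr_eq0 opprB addrACA -opprD -scalerDr half subrr.
Qed.

End DegreeZero.

(** * Interpolation *)

Lemma hermite_interpolation (K : fieldType) (M : nat) (p : K -> {poly K})
    (l : seq K) :
  exists f, forall c, c \in l -> ('X - c%:P) ^+ M %| f - p c.
Proof.
elim: l => [|c l [f fP]]; first by exists 0.
have [c_l|c_l] := boolP (c \in l).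
  by exists f => x; rewrite inE => /predU1P[->|]; apply: fP.
pose P : {poly K} := \prod_(x <- l) ('X - x%:P) ^+ M.
have coP : coprimep P (('X - c%:P) ^+ M).
  apply/coprimep_expr; rewrite coprimep_XsubC rootE horner_prod.
  rewrite prodf_seq_neq0; apply/allP => x x_l /=.
  rewrite horner_exp hornerXsubC expf_neq0 // subr_eq0.
  by apply: contraNneq c_l => ->.
have /Bezout_eq1_coprimepP[[u v] /= E] := coP.
(* By Bezout, u P is 0 modulo the old nodes and 1 modulo the new one. *)
exists (f + u * P * (p c - f)) => x; rewrite inE => /predU1P[->|x_l].
  rewrite (_ : _ - _ = (p c - f) * (u * P - 1)); last by ring.
  by rewrite -E opprD addNKr -mulNr mulrA dvdp_mull.
rewrite addrAC dvdp_add ?fP // dvdp_mulr // dvdp_mull // /P (big_rem x) //=.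
by rewrite dvdp_mulr.
Qed.

(** * Signs, reflections and interpolation nodes *)

Section Signs.
Variable R : realType.
Local Notation C := R[i].
Implicit Types (e : sign) (s : C) (k : int).

Definition esgn e k : C := if e is Minus then (-1) ^ (k + 1) else -1.

(* The value that condition star prescribes to an [s i] in [1/2 + Z]. *)
Definition half_point e : C := if e is Minus then 2^-1 else - 2^-1.

Definition symm e s : bool := (s == 0) || (s == half_point e).
(** In the symmetric cases this is 2s for minus and 2s + 1 for plus, the value for which j -> eps +
    k - j negates [center]. It is never negative, as [degree0_bracket] demands. *)
Definition epsi e s : int :=
  if e is Minus then (s != 0)%:Z else (s == 0)%:Z.

Lemma signz_sqr k : ((-1) ^ k * (-1) ^ k : C) = 1.
Proof. by rewrite -expfzMl mulrNN mulr1 exp1rz. Qed.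

Lemma signzD k l : (-1) ^ (k + l) = (-1) ^ k * (-1) ^ l :> C.
Proof. by rewrite expfzDr // oppr_eq0 oner_eq0. Qed.

Lemma esgn_sq e k : esgn e k * esgn e k = 1.
Proof. by case: e => /=; rewrite ?signz_sqr // mulrNN mulr1. Qed.

Lemma esgnM e k l : esgn e k * esgn e l = - esgn e (k + l).
Proof.
case: e; rewrite /= ?mulrN1 ?opprK //.
by rewrite !signzD expr1z !mulrN1 mulrNN opprK.
Qed.

Lemma esgn_parity k : esgn Minus k = if (2 %| k)%Z then -1 else 1.
Proof.
have dbl t : (-1) ^ (t + t) = 1 :> C by rewrite signzD signz_sqr.
case: ifP => [/dvdzP[t ->]|dk] /=.
  have -> : t * 2 + 1 = t + t + 1 by lia.
  by rewrite signzD dbl mul1r expr1z.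
have km : (k %% 2)%Z != 0 by apply: contraFneq dk => /dvdz_mod0P.
have := divz_eq k 2; have := modz_ge0 k (isT : (2 : int) != 0).
have := ltz_pmod k (isT : 0 < (2 : int)).
move: (k %/ 2)%Z (k %% 2)%Z km => t r km r2 r0 ->.
have -> : t * 2 + r + 1 = (t + 1) + (t + 1) by lia.
exact: dbl.
Qed.

(** Brings all kinds of summands into the form [symg], so that every later argument is made once. *)
Lemma g_compE e m s :
  g_comp e s = @symg R m (symm e s) (epsi e s) (esgn e).
Proof.
(* i + j and j - i have the same parity: the sign depends on the degree alone. *)
have sgn_ij (i j : int) : (-1) ^ (i + j + 1) = (-1) ^ (j - i + 1) :> C.
  have -> : i + j + 1 = (i + i) + (j - i + 1) by lia.
  by rewrite signzD [(-1) ^ (i + i)]signzD signz_sqr mul1r.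
have E (b : bool) eps (F : int -> int -> C) (A : set (glhat R m)) : b ->
    (forall i j, F i j = esgn e (j - i)) ->
    A = [set x | gl_inf x /\
      forall i j, x.1 i j = F i j *: uopp (x.1 (eps - j) (eps - i))] ->
    A = @symg R m b eps (esgn e).
  move=> hb FE ->; apply/seteqP; split=> x [gx sx]; split=> //.
    by move=> _ i j; rewrite sx FE.
  by move=> i j; rewrite sx // FE.
have E' eps (A : set (glhat R m)) : A = @gl_inf R m -> A = symg false eps (esgn e).
  by move=> ->; apply/seteqP; split=> x // [].
rewrite /symm; case: e E E' => /= E E'.
  have [->|s0] := eqVneq s 0.
    apply: (E _ _ (fun i j => (-1) ^ (i + j + 1))) => //.
    by apply/seteqP; split=> x [gx sx]; split=> // i j; rewrite sx ?sub0r.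
  have [_|_] := eqVneq s 2^-1; last exact: E'.
  exact: (E _ _ (fun i j => (-1) ^ (i + j + 1))).
have [->|s0] := eqVneq s 0.
  apply: (E _ _ (fun i j => -1)) => //.
  by apply/seteqP; split=> x [gx sx]; split=> // i j; rewrite sx ?scaleN1r.
have [_|_] := eqVneq s (- 2^-1); last exact: E'.
apply: (E _ _ (fun i j => -1)) => //.
by apply/seteqP; split=> x [gx sx]; split=> // i j; rewrite sx ?scaleN1r ?sub0r.
Qed.

Definition offset e k : C := if e is Minus then k%:~R / 2 else (k + 1)%:~R / 2.

(* On column [j] of [phi_s (t^k g(D + offset))] the polynomial [g] is evaluated at
   [center + u]. *)
Definition center e s k (j : int) : C := s - j%:~R + offset e k.

Lemma centerN e s k j : symm e s ->
  center e s k (epsi e s + k - j) = - center e s k j.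
Proof.
have n0 : (2 : C) != 0 by rewrite pnatr_eq0.
have h0 : (2^-1 : C) != 0 by rewrite invr_eq0.
rewrite /symm /center /offset /epsi => /orP[]/eqP->; case: e => /=;
  rewrite ?eqxx ?oppr_eq0 ?h0 ?(negbTE h0) /= !rmorphD ?rmorphN /=; by field.
Qed.

Lemma center_inj e s k : injective (center e s k).
Proof. by move=> j j' /addIr /addrI /oppr_inj /intr_inj. Qed.

Lemma center_eq e s s' k j j' :
  center e s k j = center e s' k j' -> is_integer (s - s').
Proof.
move=> /addIr E; exists (j - j').
rewrite rmorphB /= -[s](subrK j%:~R) E; ring.
Qed.

Lemma center_eqN e s s' k j j' :
  center e s k j = - center e s' k j' -> is_integer (s + s').
Proof.
rewrite /center => E; exists (j + j' - (if e is Minus then k else k + 1)).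
have -> : s = j%:~R - s' + j'%:~R - offset e k - offset e k.
  by rewrite -[s](addrK (- j%:~R + offset e k)) addrA E; ring.
have n0 : (2 : C) != 0 by rewrite pnatr_eq0.
by rewrite /offset; case: e {E}; rewrite !rmorphD rmorphN /= ?rmorphD /=; field.
Qed.

Lemma star_half e N (s : 'I_N -> C) i :
  star e s -> is_integer (2 * s i) -> symm e (s i).
Proof.
have n0 : (2 : C) != 0 by rewrite pnatr_eq0.
case=> s_int s_half _ [n En]; have {}En : s i = n%:~R / 2 by rewrite -En; field.
have := divz_eq n 2; have := modz_ge0 n (isT : (2 : int) != 0).
have := ltz_pmod n (isT : 0 < (2 : int)).
move: (n %/ 2)%Z (n %% 2)%Z => t r r2 r0 n_eq; apply/orP.
have [r_eq|r_eq] : r = 0 \/ r = 1 by lia.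
  left; apply/eqP/s_int; exists t; rewrite En n_eq r_eq addr0 rmorphM /=.
  by field.
right; apply/eqP/s_half; exists t; rewrite En n_eq r_eq rmorphD rmorphM /=.
by field.
Qed.

(** Interpolate at the centers and at their opposites, then symmetrize under X -> -X to get the
    parity. By condition star an opposite meets a center only within a symmetric component, and
    there [sa] makes the two prescribed values agree. *)
Lemma interpolation e N (m : 'I_N -> nat) (s : 'I_N -> C) k i
    (a : int -> {poly %/ ('X^((m i).+1) : {poly R[i]})}) (B : nat) :
  star e s -> symseq (symm e (s i)) (epsi e (s i)) (esgn e) k a ->
  exists g : {poly C}, [/\ g \Po (- 'X) = esgn e k *: g,
    forall j, (`|j| <= B)%N -> taylor (m i) g (center e (s i) k j) = a j
    & forall i' j, i' != i -> (`|j| <= B)%N ->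
        taylor (m i') g (center e (s i') k j) = 0].
Proof.
move=> st sa; have [_ _ s_ne] := st.
(* In the symmetric case f(X) and f(-X) contribute the same value, hence 1/2. *)
pose lam : C := if symm e (s i) then 2^-1 else 1.
pose M := (\max_(i < N) m i).+1.
(* Defined for centers of all columns: the opposite of a center with |j| <= B may be a center
   outside that range. *)
pose p (c : C) : {poly C} :=
  if pselect (exists j, c = center e (s i) k j) is left H
  then shift (lam *: (a (sval (cid H)) : {poly C})) (- c) else 0.
have p_center j :
    taylor (m i) (p (center e (s i) k j)) (center e (s i) k j) = lam *: a j.
  rewrite /p; case: pselect => [H|]; last by case; exists j.
  case: cid => j' /= /center_inj <-.
  by rewrite taylor_shiftN linearZ /= tpolyK.
have p_0 i' c : (forall j, c <> center e (s i) k j) -> taylor (m i') (p c) c = 0.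
  by move=> nc; rewrite /p; case: pselect => [[j /nc]//|_]; rewrite taylor0.
pose cs := [seq center e (s i') k j | i' <- enum 'I_N, j <- irange B].
have [f fP] := hermite_interpolation M p (cs ++ [seq - c | c <- cs]).
have cs_in i' j : (`|j| <= B)%N -> center e (s i') k j \in cs.
  by move=> le_j; apply: allpairs_f; rewrite ?mem_enum ?mem_irange.
have f_p i' c : c \in cs ++ [seq - c | c <- cs] ->
    taylor (m i') f c = taylor (m i') (p c) c.
  move=> /fP d; apply/eqP; rewrite -subr_eq0 -taylorB; apply/eqP/taylor_dvd.
  by apply: dvdp_trans d; rewrite dvdp_exp2l // ltnS leq_bigmax.
exists (f + esgn e k *: (f \Po (- 'X))).
have gE i' j : (`|j| <= B)%N ->
    taylor (m i') (f + esgn e k *: (f \Po (- 'X))) (center e (s i') k j) =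
    taylor (m i') (p (center e (s i') k j)) (center e (s i') k j) +
    esgn e k *:
      uopp (taylor (m i') (p (- center e (s i') k j)) (- center e (s i') k j)).
  move=> le_j; rewrite taylorD taylorZ taylor_oppX !f_p //.
    by rewrite mem_cat map_f ?orbT // cs_in.
  by rewrite mem_cat cs_in.
split.
- rewrite comp_polyD comp_polyZ -comp_polyA raddfN /= comp_polyX opprK comp_polyXr.
  by rewrite scalerDr scalerA esgn_sq scale1r addrC.
- move=> j le_j; rewrite gE // p_center.
  have [hb|hb] := boolP (symm e (s i)).
    rewrite -centerN // p_center uoppZ scalerA mulrC -scalerA -sa //.
    rewrite -mulr2n -scaler_nat scalerA /lam hb mulfV ?scale1r //.
    by rewrite pnatr_eq0.
  rewrite p_0 ?linear0 ?scaler0 ?addr0 /lam ?(negbTE hb) ?scale1r // => j' E.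
  move: hb; rewrite (star_half st) //.
  have -> : 2 * s i = s i + s i by ring.
  by apply: (@center_eqN e _ _ k j' j).
move=> i' j ne_i le_j; have ne : i' <> i by apply/eqP.
rewrite gE // !p_0 ?linear0 ?scaler0 ?addr0 // => j' E.
  by have [_] := s_ne _ _ ne; apply; rewrite addrC; apply: (@center_eqN e _ _ k j' j).
by have [+ _] := s_ne _ _ ne; apply; apply: center_eq E.
Qed.

End Signs.

(** * Summands of the direct sum *)

Section Components.
Variables (R : realType) (e : sign) (N : nat) (m : 'I_N -> nat) (s : 'I_N -> R[i]).
Local Notation C := R[i].
Local Notation L := (gvec_space R m).
Local Notation G i := (@g_comp R e (m i) (s i)).

Definition single (i : 'I_N) (x : glhat R (m i)) : L :=
  @upd C N (fun i => glhat R (m i)) (fun=> 0) i x.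

Lemma single_in i x : @single i x i = x.
Proof. exact: eqtype.dfwith_in. Qed.
Lemma single_out i i' x : i != i' -> @single i x i' = 0.
Proof. by move=> ne; apply: eqtype.dfwith_out. Qed.

Lemma gvec_eqP (x y : L) : (forall i, x i = y i) -> x = y.
Proof. exact: functional_extensionality_dep. Qed.

Lemma single_is_linear i : linear (@single i).
Proof.
move=> a x y; apply: gvec_eqP => i'.
have -> : (a *: single x + single y) i' = a *: single x i' + single y i' by [].
have [<-|ne] := eqVneq i i'; first by rewrite !single_in.
by rewrite !single_out // scaler0 addr0.
Qed.
HB.instance Definition _ i :=
  GRing.isLinear.Build C (glhat R (m i)) L *:%R (@single i) (@single_is_linear i).

Lemma gvec_sumE (I : Type) (r : seq I) (F : I -> L) i :
  (\sum_(j <- r) F j) i = \sum_(j <- r) F j i.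
Proof.
elim: r => [|j r IHr]; first by rewrite !big_nil.
by rewrite !big_cons -IHr.
Qed.

Lemma sum_single (x : L) : x = \sum_i single (x i).
Proof.
apply: gvec_eqP => i; rewrite gvec_sumE (bigD1 i) //= single_in big1 ?addr0 //.
by move=> j ne; rewrite single_out.
Qed.

Lemma g_comp_subspace i : subspace (G i).
Proof. by rewrite g_compE; exact: symg_subspace. Qed.

Lemma gvec_subspace : subspace (gvec e s : set L).
Proof.
split=> [i|a x y gx gy i]; first by case: (g_comp_subspace i).
by case: (g_comp_subspace i) => _; apply; [exact: gx | exact: gy].
Qed.

Lemma gvec_single i x : G i x -> gvec e s (single x).
Proof.
move=> gx i'; have [<-|ne] := eqVneq i i'; first by rewrite single_in.
by rewrite single_out //; case: (g_comp_subspace i').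
Qed.

Lemma glhat_br0 n : glhat_br (0 : glhat R n) 0 = 0.
Proof.
rewrite -(band0 R n 0) glhat_br_band; apply/bandP.
split=> [j|]; first by rewrite !mul0r subrr.
by apply: fsbig1 => i _; rewrite !mulr0.
Qed.

Lemma gvec_br_single i x y :
  gvec_br (@single i x) (single y) = single (glhat_br x y).
Proof.
apply: gvec_eqP => i'; rewrite /gvec_br.
have [<-|ne] := eqVneq i i'; first by rewrite !single_in.
by rewrite !single_out // glhat_br0.
Qed.

Lemma band_decomposition n (x : glhat R n) : gl_inf x ->
  exists B, x = \sum_(k <- irange B)
    band k (fun j => x.1 (j - k) j) (if k == 0 then x.2 else 0).
Proof.
case=> B xB; exists B.
have sum1 (F : int -> glhat R n) : (\sum_(k <- irange B) F k).1 =
    fun i j => \sum_(k <- irange B) (F k).1 i j.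
  apply/funext => i; apply/funext => j.
  elim: (irange B) => [|k r IHr]; first by rewrite !big_nil.
  by rewrite !big_cons -IHr.
have sum2 (F : int -> glhat R n) : (\sum_(k <- irange B) F k).2 =
    \sum_(k <- irange B) (F k).2.
  elim: (irange B) => [|k r IHr]; first by rewrite !big_nil.
  by rewrite !big_cons -IHr.
rewrite [LHS]surjective_pairing [RHS]surjective_pairing sum1 sum2; congr (_, _).
  apply/funext => i; apply/funext => j; rewrite -fsum_irange => [|k lt_k] /=.
    rewrite (@fsum_single _ (j - i)) ?eqxx ?subKr // => k.
    by rewrite eq_sym => /negbTE->.
  by case: eqP => // E; rewrite xB //; lia.
rewrite -fsum_irange => [|k lt_k] /=.
  by rewrite (@fsum_single _ 0) ?eqxx // => k /negbTE->.
by case: eqP => // E; lia.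
Qed.

Section Action.
Variables (V : lmodType C) (act : L -> V -> V).
Hypothesis Hact : lie_module (gvec e s) (@gvec_br R N m) act.

Lemma component_lie_module i :
  lie_module (G i) (@glhat_br R (m i)) (fun x => act (single x)).
Proof.
case: Hact => H1 H2 H3; split=> [x gx|v a x y gx gy|x y v gx gy].
- by apply: H1; exact: gvec_single.
- by rewrite linearP H2 //; exact: gvec_single.
by rewrite -gvec_br_single H3 //; exact: gvec_single.
Qed.

Definition component_smooth := forall i,
  smooth (symm e (s i)) (epsi e (s i)) (esgn R e) (fun x => act (@single i x)).

Lemma quasifinite_component_smooth :
  (exists Vd, graded_module (gvec e s) (@gvec_deg R N m) act Vd /\
     forall j, finite_dimensional (Vd j)) -> component_smooth.
Proof.
case=> Vd [[Vgr Vdeg] Vfin] i.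
apply: (@quasifinite_smooth R (m i)).
- exact: esgnM.
- exact: esgn_sq.
- by rewrite -g_compE; exact: component_lie_module.
exists Vd; split=> //; split=> // k j x v gx dx Vv; apply: Vdeg => //.
  by apply: gvec_single; rewrite g_compE.
move=> i'; have [<-|ne] := eqVneq i i'; first by rewrite single_in.
by rewrite single_out //; split.
Qed.

(** Compare z with - z = z(-u): even powers of u have equal coefficients and odd ones act by 0, so z
    and - z act alike. *)
Lemma odd_center_act0 i z v : odd_center_zero s act -> symm e (s i) ->
  uopp z = - z -> act (single (band 0 (fun=> 0) z : glhat R (m i))) v = 0.
Proof.
move=> odd0 sym_i z_odd.
have n0 : (2 : C) != 0 by rewrite pnatr_eq0.
have int2s : is_integer (2 * s i).
  case/orP: sym_i => /eqP->; first by exists 0; rewrite mulr0.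
  by case: (e) => /=; [exists 1 | exists (-1)]; rewrite ?mulrN mulfV.
have [f Ef] := tpoly_surj z; pose c t := act (@central_u R N m i t) v.
have gc t : gvec e s (@central_u R N m i t).
  apply: gvec_single; rewrite g_compE; split; first by exists 0%N.
  move=> _ j k; have z0 j' k' : ((0, u_ R (m i) ^+ t) : glhat R (m i)).1 j' k' = 0 by [].
  by rewrite !z0 linear0 scaler0.
have actE (x : nat -> C) : act (single (band 0 (fun=> 0)
    (\sum_(t < size f) x t *: u_ R (m i) ^+ t) : glhat R (m i))) v =
    \sum_(t < size f) x t *: c t.
  have -> : single (band 0 (fun=> 0) (\sum_(t < size f) x t *: u_ R (m i) ^+ t)
      : glhat R (m i)) = \sum_(t < size f) x t *: @central_u R N m i t.
    rewrite (_ : \sum_(t < size f) _ *: @central_u _ _ _ _ _ =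
      single (\sum_(t < size f) x t *: ((0, u_ R (m i) ^+ t) : glhat R (m i)))).
      congr single; elim/big_ind2: _ => [|y1 y2 z1 z2 <- <-|t _].
      - exact: band0.
      - by rewrite bandD; apply/bandP; split=> // j; rewrite addr0.
      have -> : ((0, u_ R (m i) ^+ t) : glhat R (m i)) =
          band 0 (fun=> 0) (u_ R (m i) ^+ t).
        congr (_, _); apply/funext => j; apply/funext => k.
        by rewrite if_same.
      by rewrite bandZ; apply/bandP; split=> // j; rewrite scaler0.
    by rewrite linear_sum; apply: eq_bigr => t _; rewrite linearZ.
  rewrite (act_sumv gvec_subspace Hact) => [|t]; last first.
    by apply: (subspaceZ gvec_subspace); exact: gc.
  by apply: eq_bigr => t _; rewrite (actZv gvec_subspace Hact).
have zE : z = \sum_(t < size f) f`_t *: u_ R (m i) ^+ t.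
  rewrite Ef -[f in LHS]coefK poly_def linear_sum; apply: eq_bigr => t _.
  by rewrite linearZ /= rmorphXn.
have NzE : - z = \sum_(t < size f) (f`_t * (-1) ^+ t) *: u_ R (m i) ^+ t.
  rewrite -z_odd zE linear_sum; apply: eq_bigr => t _.
  rewrite linearZ /= rmorphXn /= -tpolyX uoppE comp_polyX linearN /=.
  rewrite -scalerA; congr (_ *: _).
  by rewrite [LHS]exprNn -signr_odd mulr_sign -[in RHS]signr_odd scaler_sign.
have E : act (single (band 0 (fun=> 0) (- z) : glhat R (m i))) v =
    act (single (band 0 (fun=> 0) z : glhat R (m i))) v.
  rewrite NzE (actE (fun t => f`_t * (-1) ^+ t)) zE (actE (fun t => f`_t)).
  apply: eq_bigr => t _.
  have [t_odd|t_even] := boolP (odd t).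
    by rewrite /c odd0 // !scaler0.
  by rewrite -signr_odd (negbTE t_even) expr0 mulr1.
have gz : gvec e s (single (band 0 (fun=> 0) z : glhat R (m i))).
  apply: gvec_single; rewrite g_compE; apply: symg_band => _ j.
  by rewrite linear0 scaler0.
have Nb : band 0 (fun=> 0) (- z) = - (band 0 (fun=> 0) z) :> glhat R (m i).
  by rewrite bandN; apply/bandP; split=> // j; rewrite oppr0.
move: E; rewrite Nb linearN -scaleN1r (actZv gvec_subspace Hact) //.
rewrite scaleN1r => /eqP; rewrite eq_sym -addr_eq0 -mulr2n -scaler_nat scaler_eq0.
by rewrite (negbTE n0) => /eqP.
Qed.

End Action.
End Components.

(** * Submodules over the subalgebra of differential operators *)

Section Submodules.
Variables (R : realType) (e : sign) (N : nat) (m : 'I_N -> nat) (s : 'I_N -> R[i]).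
Local Notation C := R[i].
Local Notation L := (gvec_space R m).

Lemma dhat_pmP (x : dhat R) : dhat_pm e x <->
  fin_supp x.1 /\ forall k, exists f : {poly C},
    f \Po (- 'X) = esgn R e k *: f /\ x.1 k = shift f (offset R e k).
Proof.
rewrite /dhat_pm /odd_polynomial /even_polynomial; case: e => /=; last first.
  by split=> -[xf xP]; split=> // k; have [f [pf ->]] := xP k; exists f; move: pf;
    rewrite scaleN1r.
split=> -[xf xP]; split=> // k; have [f [pf ->]] := xP k; exists f; move: pf;
  rewrite -/(esgn R Minus k) esgn_parity; case: ifP => _;
  by rewrite ?scaleN1r ?scale1r.
Qed.

(** The reflection of columns negates [center], so the parity of f is the symmetry of its matrix. *)
Lemma phihat_g_comp n (z : C) (x : dhat R) : dhat_pm e x ->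
  g_comp e z (phihat n z x).
Proof.
case/dhat_pmP => xf xP; rewrite g_compE; split.
  have [B x0] := finite_supp_bound xf; exists B => i j lt_B.
  by rewrite /phihat /phi /= x0 ?taylor0 //; lia.
move=> hb i j; rewrite /phihat /phi /=.
have -> : epsi e z - i - (epsi e z - j) = j - i by lia.
have [f [pf ->]] := xP (j - i); rewrite !taylor_shift.
have -> : z - (epsi e z - i)%:~R + offset R e (j - i) =
    - center e z (j - i) j.
  by rewrite -centerN // /center; congr (_ - _%:~R + _); lia.
by rewrite -taylor_oppX pf taylorZ scalerA esgn_sq scale1r.
Qed.

Lemma phihat_vec_gvec (x : dhat R) : dhat_pm e x -> gvec e s (phihat_vec m s x).
Proof. by move=> Dx i; exact: phihat_g_comp. Qed.

Definition mono k (f : {poly C}) : dhat R :=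
  ((fun n : int => if n == k then f else 0), 0).

Lemma mono_pm k g : g \Po (- 'X) = esgn R e k *: g ->
  dhat_pm e (mono k (shift g (offset R e k))).
Proof.
move=> pg; apply/dhat_pmP; split.
  apply: (@sub_finite_set _ _ [set k]); last exact: finite_set1.
  by move=> n /=; case: eqP.
move=> n; rewrite /=; case: eqP => [->|_]; first by exists g.
by exists 0; rewrite /shift !comp_poly0 scaler0.
Qed.

Lemma phihat_mono k g n z : k != 0 ->
  phihat n z (mono k (shift g (offset R e k))) =
  band k (fun j => taylor n g (center e z k j)) 0.
Proof.
move=> k0; congr (_, _); last first.
  by rewrite /= eq_sym (negbTE k0) linear0 add0r scale0r.
apply/funext => i; apply/funext => j; rewrite /phi /=.
by case: ifP => _; rewrite ?taylor0 // taylor_shift.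
Qed.

Variables (V : lmodType C) (act : L -> V -> V).
Hypothesis Hact : lie_module (gvec e s) (@gvec_br R N m) act.
Hypothesis Hsmooth : component_smooth e s act.
Hypothesis Hstar : star e s.
Hypothesis Hodd : odd_center_zero s act.

Variable W : set V.
Hypothesis HW : submodule (dhat_pm e) (fun x => act (phihat_vec m s x)) W.

(* On a given vector, finitely many entries of [a] matter, and those are the
   values of a single polynomial, which may be prescribed to vanish at the
   relevant entries of the other components. *)
Lemma submodule_band i k a v : k != 0 ->
  symseq (symm e (s i)) (epsi e (s i)) (esgn R e) k a -> W v ->
  W (act (single (band k a 0 : glhat R (m i))) v).
Proof.
move=> k0 sa Wv.
have /choice[Bs HB] : forall i', exists B : nat, forall a',
    symseq (symm e (s i')) (epsi e (s i')) (esgn R e) k a' ->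
    (forall j, (`|j| <= B)%N -> a' j = 0) ->
    act (single (band k a' 0 : glhat R (m i'))) v = 0.
  by move=> i'; have [B HB] := Hsmooth i' v k0; exists B => a'; apply: HB.
pose B := \max_i Bs i.
have [g [pg g_i g_0]] := interpolation B Hstar sa.
pose x := mono k (shift g (offset R e k)).
have Dx : dhat_pm e x by exact: mono_pm.
have -> : act (single (band k a 0 : glhat R (m i))) v = act (phihat_vec m s x) v.
  have gx i' : symg (symm e (s i')) (epsi e (s i')) (esgn R e)
      (band k (fun j => taylor (m i') g (center e (s i') k j)) 0).
    by have := phihat_g_comp (m i') (s i') Dx; rewrite /x phihat_mono // g_compE.
  have sg i' : symseq (symm e (s i')) (epsi e (s i')) (esgn R e) k
      (fun j => taylor (m i') g (center e (s i') k j)).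
    exact: symg_band_seq (gx i').
  rewrite [in RHS](sum_single (phihat_vec m s x)).
  rewrite (act_sumv (gvec_subspace _ _ _) Hact) => [|i']; last first.
    by apply: gvec_single; exact: phihat_g_comp.
  rewrite (bigD1 i) //= [X in _ + X]big1 => [|i' ne].
    rewrite addr0 /phihat_vec /x phihat_mono //.
    (* The second summand vanishes on the columns |j| <= B and therefore kills [v]. *)
    rewrite (_ : band k (fun j => taylor (m i) g _) 0 = band k a 0 +
      band k (fun j => taylor (m i) g (center e (s i) k j) + (-1) *: a j) 0).
      rewrite linearD /= (actDv Hact).
      - rewrite [X in _ + X](HB i) ?addr0 //.
          by apply: symseqD => //; exact: symseqZ.
        move=> j le_j; rewrite g_i ?scaleN1r ?subrr //.
        exact: leq_trans le_j (leq_bigmax i).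
      - by apply: gvec_single; rewrite g_compE; exact: symg_band.
      - apply: gvec_single; rewrite g_compE; apply: symg_band.
        by apply: symseqD => //; exact: symseqZ.
    rewrite bandD addr0; apply/bandP; split=> // j.
    by rewrite scaleN1r addrC subrK.
  rewrite /phihat_vec /x phihat_mono //; apply: HB => // j le_j.
  by rewrite g_0 //; exact: leq_trans le_j (leq_bigmax i').
by case: HW => _; apply.
Qed.

Lemma submodule_band0 i d z v :
  symseq (symm e (s i)) (epsi e (s i)) (esgn R e) 0 d -> W v ->
  W (act (single (band 0 d z : glhat R (m i))) v).
Proof.
move=> sd Wv; have [Wsub _] := HW; have [W0 Wlin] := Wsub.
have eps0 : 0 <= epsi e (s i) by rewrite /epsi; case: e.
have [r [a [a' [z' [r0 sa sa' E Hz']]]]] :=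
  degree0_bracket (@esgnM R e) (@esgn_sq R e) z eps0 sd.
have ga : gvec e s (single (band r a 0 : glhat R (m i))).
  by apply: gvec_single; rewrite g_compE; exact: symg_band.
have ga' : gvec e s (single (band (- r) a' 0 : glhat R (m i))).
  by apply: gvec_single; rewrite g_compE; exact: symg_band.
have gz' : gvec e s (single (band 0 (fun=> 0) z' : glhat R (m i))).
  apply: gvec_single; rewrite g_compE; apply: symg_band => _ j.
  by rewrite linear0 scaler0.
have gb : gvec e s (single (glhat_br (band r a 0) (band (- r) a' 0) : glhat R (m i))).
  rewrite -[glhat_br _ _](addrK (band 0 (fun=> 0) z')) -E linearB /= -scaleN1r addrC.
  apply: (proj2 (gvec_subspace _ _ _)) => //.
  by apply: gvec_single; rewrite g_compE; exact: symg_band.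
rewrite E linearD /= (actDv Hact) //.
have -> : act (single (band 0 (fun=> 0) z' : glhat R (m i))) v = 0.
  case: ifP Hz' => [hs|_ ->]; first exact: (odd_center_act0 Hact).
  by rewrite band0 linear0 (act0v (gvec_subspace _ _ _) Hact).
rewrite addr0 -gvec_br_single; case: Hact => _ _ -> //.
have N0 : - r != 0 by rewrite oppr_eq0.
rewrite -scaleN1r addrC; apply: Wlin.
  by apply: submodule_band => //; exact: submodule_band.
by apply: submodule_band => //; exact: submodule_band.
Qed.

Lemma smooth_submodule : submodule (gvec e s) act W.
Proof.
have [Wsub _] := HW; have [W0 Wlin] := Wsub; split=> // x v gx Wv.
rewrite (sum_single x) (act_sumv (gvec_subspace _ _ _) Hact) => [|i]; last first.
  by apply: gvec_single; exact: gx.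
have Wsum (I : Type) (r : seq I) (F : I -> V) :
    (forall i, W (F i)) -> W (\sum_(i <- r) F i).
  move=> WF; elim/big_ind: _ => // u w Wu Ww.
  by rewrite -[u]scale1r; exact: Wlin.
apply: (Wsum 'I_N) => i; have := gx i; rewrite g_compE => gxi.
have [B ->] := band_decomposition (proj1 gxi).
have gb k : symg (symm e (s i)) (epsi e (s i)) (esgn R e)
  (band k (fun j => (x i).1 (j - k) j) (if k == 0 then (x i).2 else 0)).
  by apply: symg_band; exact: symg_seq.
rewrite linear_sum (act_sumv (gvec_subspace _ _ _) Hact) => [|k]; last first.
  by apply: gvec_single; rewrite g_compE.
apply: (Wsum int) => k; have [->|k0] := eqVneq k 0.
  by apply: submodule_band0 => //; exact: symg_seq.
by apply: submodule_band => //; exact: symg_seq.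
Qed.

End Submodules.

(** * Highest weight modules *)

Section SpectralProjection.
Variables (K : numFieldType) (V : lmodType K) (D : V -> V) (mu : K).

(* [prod_(1 <= i <= M) (D - mu + i) / i], the projection onto the eigenvalue [mu]
   along the eigenvalues [mu - 1, ..., mu - M]. *)
Fixpoint spectral_proj (M : nat) (w : V) : V :=
  if M is n.+1 then
    let w' := spectral_proj n w in n.+1%:R^-1 *: (D w' + (n.+1%:R - mu) *: w')
  else w.

Hypothesis D_linear : linear D.

Lemma spectral_proj_linear M : linear (spectral_proj M).
Proof.
elim: M => // M IHM c x y /=; rewrite !IHM D_linear; set t := _ - mu.
rewrite [t *: (_ + _)]scalerDr [t *: (c *: _)]scalerA [t * c]mulrC -scalerA.
rewrite addrACA -scalerDr [LHS]scalerDr; congr (_ + _).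
by rewrite !scalerA mulrC.
Qed.

(** The scalar is 1 for t = 0 and 0 for t = 1, ..., M. *)
Lemma spectral_proj_eigen M t w : D w = (mu - t) *: w ->
  spectral_proj M w = (\prod_(i < M) ((i.+1%:R - t) / i.+1%:R)) *: w.
Proof.
have D0 c x : D (c *: x) = c *: D x.
  by rewrite -[c *: x]addr0 D_linear (linear_at0 D_linear) addr0.
move=> Dw; elim: M => [|M IHM]; first by rewrite big_ord0 scale1r.
rewrite big_ord_recr /= IHM D0 Dw !scalerA -scalerDl scalerA; congr (_ *: _).
by ring.
Qed.

End SpectralProjection.

Section HighestWeight.
Variable R : realType.
Local Notation C := R[i].
Local Notation Rm m := ({poly %/ ('X^(m.+1) : {poly R[i]})}).

Variables (m : nat) (b : bool) (eps : int) (eta : int -> C).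
Hypothesis etaM : forall k l, eta k * eta l = - eta (k + l).
Hypothesis eta_sq : forall k, eta k * eta k = 1.
Local Notation symg := (@symg R m b eps eta).
Local Notation symseq := (symseq b eps eta).

(** The diagonal -j already brackets as the degree; the shift by eps/2 makes it antisymmetric under
    the reflection, hence an element of the algebra. *)
Definition euler : glhat R m := band 0 (fun j => (eps%:~R / 2 - j%:~R)%:A) 0.

Lemma euler_symg : symg euler.
Proof.
apply: symg_band => _ j.
have -> : eta 0 = -1 by have := etaM 0 0; rewrite addr0 eta_sq => ->; rewrite opprK.
have n0 : (2 : C) != 0 by rewrite pnatr_eq0.
rewrite uoppZ rmorph1 scalerA; congr (_ *: _).
by rewrite addr0 rmorphB /=; field.
Qed.

Lemma glhat_br_euler k (x : glhat R m) : glhat_deg k x ->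
  glhat_br euler x = k%:~R *: x.
Proof.
move=> dx; rewrite (degE dx) glhat_br_band add0r bandZ; apply/bandP; split=> [j|].
  rewrite subr0 -scalerAl -scalerAr mul1r mulr1 -scalerBl; congr (_ *: _).
  by rewrite rmorphB /=; ring.
have [->|k0] := eqVneq k 0; last first.
  by case: dx => _ ->; rewrite ?scaler0 //; apply/eqP.
rewrite scale0r /cocycle; apply: fsbig1 => i _.
by rewrite addr0 subrr mul0r.
Qed.

Lemma symg_br k l (x y : glhat R m) :
    symg x -> glhat_deg k x -> symg y -> glhat_deg l y ->
  symg (glhat_br x y) /\ glhat_deg (k + l) (glhat_br x y).
Proof.
move=> gx dx gy dy; rewrite (degE dx) (degE dy).
move: (symg_seq k gx) (symg_seq l gy).
move: (fun j => x.1 (j - k) j) (fun j => y.1 (j - l) j) => a a' sa sa'.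
rewrite glhat_br_band; split.
  apply: symg_band => hb j.
  have ua i : uopp (a (eps + k - i)) = eta k *: a i.
    by rewrite [in RHS](sa hb) scalerA eta_sq scale1r.
  have ua' i : uopp (a' (eps + l - i)) = eta l *: a' i.
    by rewrite [in RHS](sa' hb) scalerA eta_sq scale1r.
  rewrite uoppB !rmorphM /=.
  have -> : eps + (k + l) - j - l = eps + k - j by lia.
  have -> : eps + (k + l) - j - k = eps + l - j by lia.
  have -> : a (eps + (k + l) - j) = a (eps + k - (j - l)) by congr a; lia.
  have -> : a' (eps + (k + l) - j) = a' (eps + l - (j - k)) by congr a'; lia.
  rewrite !ua !ua' -!scalerAl -!scalerAr !scalerA [eta l * eta k]mulrC -scalerBr.
  rewrite scalerA etaM mulrN eta_sq scaleN1r opprB.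
  by congr (_ - _); exact: mulrC.
by split=> [i j /eqP/negPf /= -> //|/eqP/negPf /= -> //].
Qed.

Variables (V : lmodType C) (act : glhat R m -> V -> V) (Lam : glhat R m -> C).
Hypothesis Hirr : irreducible_module symg (@glhat_br R m) act.
Variable v : V.
Hypothesis v_neq0 : v <> 0.
Hypothesis v_pos : forall k x, 0 < k -> symg x -> glhat_deg k x -> act x v = 0.
Hypothesis v_zero : forall h, symg h -> glhat_deg 0 h -> act h v = Lam h *: v.

Let Hact : lie_module symg (@glhat_br R m) act. Proof. by case: Hirr. Qed.
Let gS : subspace symg. Proof. exact: symg_subspace. Qed.

(** Substitute for a grading, which is not part of the data: [depth n] collects what lowering
    operators of total degree -n make of [v]. Eigenvalues of [euler] keep the depths apart. *)
Inductive depth : int -> V -> Prop :=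
| depth_v : depth 0 v
| depth_0 n : depth n 0
| depth_act n k x w : k < 0 -> symg x -> glhat_deg k x -> depth n w ->
    depth (n - k) (act x w)
| depth_lin n c w w' : depth n w -> depth n w' -> depth n (c *: w + w').

(** The element x is commuted through the lowering operators down to v; the commutators are
    homogeneous and fall under the same induction hypothesis. *)
Lemma depth_deg n w k x : depth n w -> symg x -> glhat_deg k x ->
  depth (n - k) (act x w).
Proof.
move=> dw; elim: dw k x => {n w}
  [|n|n l y w l0 gy dy dw IH|n c w w' _ IH _ IH'] k x gx dx.
- have [k0|k0|k0] := ltrgtP k 0.
  + by apply: depth_act dx _ => //; exact: depth_v.
  + by rewrite (v_pos k0) //; exact: depth_0.
  + rewrite k0 in dx *; rewrite v_zero // -[_ *: v]addr0 subr0.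
    by apply: depth_lin; [exact: depth_v | exact: depth_0].
- by rewrite (actr0 Hact) //; exact: depth_0.
- have [gxy dxy] := symg_br gx dx gy dy.
  have -> : act x (act y w) = 1 *: act y (act x w) + act (glhat_br x y) w.
    by case: Hact => _ _ -> //; rewrite scale1r addrC subrK.
  apply: depth_lin.
    by rewrite addrAC; apply: depth_act => //; exact: IH.
  by rewrite -addrA -opprD [l + k]addrC; exact: IH.
rewrite (actD Hact) // (actZ Hact) //.
by apply: depth_lin; [exact: IH | exact: IH'].
Qed.

Lemma depth_neg n w : depth n w -> n < 0 -> w = 0.
Proof.
elim=> {n w} [|n|n l y w l0 gy dy dw IH|n c w w' _ IH _ IH'] n0 //.
  by rewrite IH ?(actr0 Hact) //; lia.
by rewrite IH // IH' // scaler0 addr0.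
Qed.

Lemma depth_top n w : depth n w -> n = 0 -> exists c, w = c *: v.
Proof.
elim=> {n w} [|n|n l y w l0 gy dy dw IH|n c w w' _ IH _ IH'] n0 //.
- by exists 1; rewrite scale1r.
- by exists 0; rewrite scale0r.
- exists 0; rewrite scale0r (depth_neg dw) ?(actr0 Hact) //; lia.
have [x ->] := IH n0; have [y ->] := IH' n0.
by exists (c * x + y); rewrite scalerDl scalerA.
Qed.

Lemma depth_euler n w : depth n w -> act euler w = (Lam euler - n%:~R) *: w.
Proof.
have ge := euler_symg.
elim=> {n w} [|n|n l y w l0 gy dy dw IH|n c w w' _ IH _ IH'].
- by rewrite subr0 v_zero //; exact: band0_deg.
- by rewrite (actr0 Hact) // scaler0.
- have E : act euler (act y w) = act y (act euler w) + act (glhat_br euler y) w.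
    by case: Hact => _ _ -> //; rewrite addrC subrK.
  rewrite E (glhat_br_euler dy) IH (actZ Hact) // (actZv gS Hact) // -scalerDl.
  by congr (_ *: _); rewrite rmorphB /=; ring.
by rewrite (actD Hact) // (actZ Hact) // IH IH' scalerDr !scalerA mulrC.
Qed.

Inductive depth_sum : V -> Prop :=
| depth_sum0 : depth_sum 0
| depth_sumD n w w' : depth n w -> depth_sum w' -> depth_sum (w + w').

Lemma depth_sum_add w w' : depth_sum w -> depth_sum w' -> depth_sum (w + w').
Proof.
elim=> [|n u u' du _ IH] sw'; first by rewrite add0r.
by rewrite -addrA; apply: depth_sumD du _; exact: IH.
Qed.

Lemma depth_sumZ c w : depth_sum w -> depth_sum (c *: w).
Proof.
elim=> [|n u u' du _ IH]; first by rewrite scaler0; exact: depth_sum0.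
rewrite scalerDr; apply: depth_sumD IH; rewrite -[c *: u]addr0.
by apply: depth_lin du _; exact: depth_0.
Qed.

Lemma depth_sum1 n w : depth n w -> depth_sum w.
Proof. by move=> dw; rewrite -[w]addr0; apply: depth_sumD dw depth_sum0. Qed.

Lemma depth_sumT w : depth_sum w.
Proof.
have [E|E] : depth_sum = [set 0] \/ depth_sum = setT.
- case: Hirr => _ _; apply; split.
    split; first exact: depth_sum0.
    by move=> c x y sx sy; apply: depth_sum_add => //; exact: depth_sumZ.
  move=> x u gx; elim=> [|n y y' dy _ IH].
    by rewrite (actr0 Hact) //; exact: depth_sum0.
  rewrite (actD Hact) //; apply: depth_sum_add => //.
  have [B ->] := band_decomposition (proj1 gx).
  have gb k : symg (band k (fun j => x.1 (j - k) j) (if k == 0 then x.2 else 0)).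
    by apply: symg_band; exact: symg_seq.
  rewrite (act_sumv gS Hact) //; elim: (irange B) => [|k r IHr].
    by rewrite big_nil; exact: depth_sum0.
  rewrite big_cons; apply: depth_sum_add => //; apply: (@depth_sum1 (n - k)).
  apply: depth_deg => //; have [->|k0] := eqVneq k 0; first exact: band0_deg.
  exact: band_deg.
- have : depth_sum v by apply: depth_sum1 depth_v.
  by rewrite E => /v_neq0.
by have : [set: V] w by []; rewrite -E.
Qed.

(** [lam] is the coordinate along v: once M exceeds the depths occurring in w, the projection kills
    everything of positive depth. Linearity holds because one M serves finitely many vectors. *)
Lemma hw_functional : exists lam : V -> C,
  [/\ scalar lam, lam v = 1 & forall w, exists M0 : nat, forall M, (M0 <= M)%N ->
     spectral_proj (act euler) (Lam euler) M w = lam w *: v].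
Proof.
have D_lin : linear (act euler) by case: Hact => + _ _; apply; exact: euler_symg.
pose p := spectral_proj (act euler) (Lam euler).
have p_lin M : linear (p M) by exact: spectral_proj_linear.
have p0 M : p M 0 = 0 by exact: linear_at0.
have pv M : p M v = v.
  rewrite /p (@spectral_proj_eigen _ _ _ _ D_lin M 0).
    rewrite big1 ?scale1r // => i _; rewrite subr0 mulfV //.
    by rewrite pnatr_eq0.
  by rewrite subr0 v_zero //; [exact: euler_symg | exact: band0_deg].
have /choice[lam lamP] : forall w, exists c, exists M0 : nat,
    forall M, (M0 <= M)%N -> p M w = c *: v.
  move=> w; elim: (depth_sumT w) => [|n y y' dy _ [c [M0 HM]]].
    by exists 0, 0%N => M _; rewrite p0 scale0r.
  have [n0|n0|n0] := ltrgtP n 0.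
  - exists c, M0 => M leM; rewrite -[y]scale1r p_lin (HM M leM) (depth_neg dy n0).
    by rewrite p0 scaler0 add0r.
  - exists c, (maxn M0 (absz n)) => M; rewrite geq_max => /andP[leM le_n].
    rewrite -[y]scale1r p_lin (HM M leM) scale1r.
    rewrite /p (spectral_proj_eigen D_lin _ (depth_euler dy)).
    have lt_n : ((absz n).-1 < M)%N by lia.
    (* The factor of index n - 1 is (n - n) / n = 0. *)
    rewrite (bigD1 (Ordinal lt_n)) //= (_ : (absz n).-1.+1%:R = n%:~R) ?subrr.
      by rewrite !mul0r scale0r add0r.
    by rewrite pmulrn; congr (_%:~R); lia.
  have [c' ->] := depth_top dy n0.
  exists (c' + c), M0 => M leM.
  by rewrite p_lin pv (HM M leM) scalerDl.
have v0 : v != 0 by apply/eqP.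
exists lam; split; last exact: lamP.
  move=> a x y; have [M1 H1] := lamP x; have [M2 H2] := lamP y.
  have [M3 H3] := lamP (a *: x + y).
  pose M := maxn M1 (maxn M2 M3).
  have : (lam (a *: x + y) - (a * lam x + lam y)) *: v = 0.
    rewrite scalerBl -(H3 M) ?p_lin; last by rewrite !leq_max leqnn !orbT.
    rewrite (H1 M) ?(H2 M) ?leq_max ?leqnn ?orbT // scalerDl scalerA.
    exact: subrr.
  by move/eqP; rewrite scaler_eq0 (negbTE v0) orbF subr_eq0 => /eqP E; exact: E.
have [M HM] := lamP v; have : (lam v - 1) *: v = 0.
  by rewrite scalerBl scale1r -(HM M) // pv subrr.
by move/eqP; rewrite scaler_eq0 (negbTE v0) orbF subr_eq0 => /eqP.
Qed.

End HighestWeight.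

(** * Functionals generated by the highest weight coordinate *)

Section DualSystem.
Variables (K : fieldType) (L V : lmodType K).
Variables (g : set L) (br : L -> L -> L) (act : L -> V -> V).
Hypothesis Hirr : irreducible_module g br act.
Variables (lam : V -> K) (v : V).
Hypotheses (lam_scalar : scalar lam) (lam_v : lam v = 1).

(* The submodule of the dual space generated by [lam]. *)
Inductive dual_orbit : (V -> K) -> Prop :=
| dual_orbit_gen : dual_orbit lam
| dual_orbit_act x mu : g x -> dual_orbit mu -> dual_orbit (fun w => mu (act x w))
| dual_orbit_lin c mu mu' : dual_orbit mu -> dual_orbit mu' ->
    dual_orbit (fun w => c * mu w + mu' w).

Lemma dual_orbit_scalar mu : dual_orbit mu -> scalar mu.
Proof.
elim=> // [x {}mu gx _ IH|c mu1 mu2 _ IH1 _ IH2] a u w.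
  by case: Hirr => -[+ _ _] _ _ => /(_ _ gx) ->; exact: IH.
by rewrite IH1 IH2 !mulrDr !mulrA [c * a]mulrC addrACA.
Qed.

(** The common kernel of the orbit is a submodule that misses v, as [lam v = 1]; by irreducibility
    it is 0. *)
Lemma dual_orbit_separates w : (forall mu, dual_orbit mu -> mu w = 0) -> w = 0.
Proof.
case: Hirr => Hact _ /(_ [set w | forall mu, dual_orbit mu -> mu w = 0]) [].
- split.
    split=> [mu dmu|a u w' u0 w0 mu dmu]; last first.
      by rewrite (dual_orbit_scalar dmu) u0 // w0 // mulr0 addr0.
    exact: scalar_at0 (dual_orbit_scalar dmu).
  move=> x u gx u0 mu dmu; apply: (u0 (fun w => mu (act x w))).
  exact: dual_orbit_act.
- by move=> E w0; have : [set 0] w by rewrite -E.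
move=> E _; have /(_ lam dual_orbit_gen) :
  [set w | forall mu, dual_orbit mu -> mu w = 0] v by rewrite E.
by rewrite lam_v => /eqP; rewrite oner_eq0.
Qed.

(* Finitely many vectors are fixed by an operator [sum_p p.1 (_) *: p.2] of finite
   rank with functionals in [dual_orbit]. *)
Lemma dual_system (ws : seq V) : exists r : seq ((V -> K) * V),
  (forall p, List.In p r -> dual_orbit p.1) /\
  (forall w, w \in ws -> w = \sum_(p <- r) p.1 w *: p.2).
Proof.
elim: ws => [|w ws [r [dr Pr]]]; first by exists [::].
pose P u := \sum_(p <- r) p.1 u *: p.2.
have [Pw|Pw] := eqVneq w (P w).
  by exists r; split=> // u; rewrite inE => /predU1P[->|/Pr].
have [mu dmu mu_w] : exists2 mu, dual_orbit mu & mu (w - P w) != 0.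
  apply: contra_neqP Pw => H; apply/eqP; rewrite -subr_eq0; apply/eqP.
  apply: dual_orbit_separates => mu dmu; apply/eqP/negPn/negP => ne.
  by apply: H; exists mu.
have mu_lin := dual_orbit_scalar dmu.
have mu0 : mu 0 = 0 by exact: scalar_at0.
pose c := (mu (w - P w))^-1.
(* mu' = c mu (1 - P) is 0 on the vectors that P fixes and 1 at w; it stays in the orbit because the
   functionals of P lie there. *)
have [mu' dmu' mu'E] : exists2 mu', dual_orbit mu' &
    forall u, mu' u = c * mu (u - P u).
  have [mu1 dmu1 mu1E] : exists2 mu1, dual_orbit mu1 &
      forall u, mu1 u = mu (u - P u).
    rewrite /P; elim: (r) dr => [|p r' IH] dr'.
      by exists mu => // u; rewrite big_nil subr0.
    have [|mu1 dmu1 mu1E] := IH; first by move=> q q_in; apply: dr'; right.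
    exists (fun u => - mu p.2 * p.1 u + mu1 u).
      by apply: dual_orbit_lin => //; apply: dr'; left.
    move=> u; rewrite big_cons mu1E.
    have -> : u - (p.1 u *: p.2 + \sum_(j <- r') j.1 u *: j.2) =
              (- p.1 u) *: p.2 + (u - \sum_(j <- r') j.1 u *: j.2).
      by rewrite opprD scaleNr addrCA.
    by rewrite mu_lin !mulNr mulrC.
  (* Multiplication by c in the form that [dual_orbit_lin] provides. *)
  exists (fun u => (c - 1) * mu1 u + mu1 u); first exact: dual_orbit_lin.
  by move=> u; rewrite mulrBl mul1r subrK mu1E.
exists ((mu', w - P w) :: r); split=> [p /= [<-//|/dr]//|u].
rewrite inE big_cons /= mu'E => /predU1P[->|/Pr Pu].
  by rewrite /c mulVf // scale1r subrK.
have uP : P u = u by rewrite /P -Pu.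
by rewrite -/(P u) uP subrr mu0 mulr0 scale0r add0r.
Qed.

End DualSystem.

(** * Tensor products *)

Section SubspaceModule.
Variables (K : fieldType) (T : lmodType K) (S : set T).
Hypothesis S_subspace : subspace S.

Let Sp : {pred T} := fun t => `[< S t >].

Let Sp_closed : submod_closed Sp.
Proof.
case: S_subspace => S0 Slin; split; first exact/asboolP.
by move=> a u w /asboolP Su /asboolP Sw; apply/asboolP; exact: Slin.
Qed.
HB.instance Definition _ := GRing.isSubmodClosed.Build K T Sp Sp_closed.

Record subspace_type := SubspaceType { subspace_val :> T; _ : subspace_val \in Sp }.
HB.instance Definition _ := [isSub for subspace_val].
HB.instance Definition _ := [Choice of subspace_type by <:].
HB.instance Definition _ := [SubChoice_isSubLmodule of subspace_type by <:].

(** The universal property of the tensor product speaks of [lmodType]s, so a span given as a set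
    must become one. *)
Lemma subspace_module : exists (U : lmodType K) (f : {linear U -> T}),
  [/\ injective f, forall u, S (f u) & forall t, S t -> exists u, f u = t].
Proof.
exists subspace_type, (val : {linear subspace_type -> T}).
split=> [|u|t St]; first exact: val_inj.
  by apply/asboolP; exact: valP u.
have tS : t \in Sp by apply/asboolP.
by exists (SubspaceType tS).
Qed.
End SubspaceModule.

Section Updates.
Variables (K : fieldType) (N : nat) (M : 'I_N -> lmodType K).
Implicit Types (x : forall i, M i).
Local Notation updi x i y := (@upd K N M x i y).

Lemma upd_in x i y : updi x i y i = y.
Proof. exact: eqtype.dfwith_in. Qed.
Lemma upd_out x i y j : i != j -> updi x i y j = x j.
Proof. by move=> ne; apply: eqtype.dfwith_out. Qed.
Lemma upd_id x i : updi x i (x i) = x.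
Proof.
apply: functional_extensionality_dep => j.
by have [<-|ne] := eqVneq i j; rewrite ?upd_in ?upd_out.
Qed.
Lemma upd_upd x i y z : updi (updi x i y) i z = updi x i z.
Proof.
apply: functional_extensionality_dep => j.
by have [<-|ne] := eqVneq i j; rewrite ?upd_in ?upd_out.
Qed.
Lemma updC x i j y z : i != j ->
  updi (updi x i y) j z = updi (updi x j z) i y.
Proof.
move=> ij; apply: functional_extensionality_dep => l.
have [<-|nj] := eqVneq j l; first by rewrite upd_in upd_out // upd_in.
rewrite upd_out //; have [<-|ni] := eqVneq i l; first by rewrite !upd_in.
by rewrite !upd_out.
Qed.
End Updates.

Section TensorProducts.
Variables (K : fieldType) (N : nat) (M : 'I_N -> lmodType K) (T : lmodType K).
Variable tau : (forall i, M i) -> T.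
Hypothesis Htau : is_tensor_product tau.
Implicit Types (x : forall i, M i).
Local Notation updi x i y := (@upd K N M x i y).

Let tau_lin : multilinear tau. Proof. by case: Htau. Qed.

Lemma tau_upd_linear x i : linear (fun y : M i => tau (updi x i y)).
Proof. by move=> a y z; exact: tau_lin. Qed.

Lemma tau_upd0 x i : tau (updi x i 0) = 0.
Proof. exact: linear_at0 (@tau_upd_linear x i). Qed.

Lemma tau_updZ x i a y : tau (updi x i (a *: y)) = a *: tau (updi x i y).
Proof. by rewrite -[a *: y]addr0 tau_lin tau_upd0 addr0. Qed.

Lemma tau_upd_sum x i (I : Type) (r : seq I) (F : I -> M i) :
  tau (updi x i (\sum_(j <- r) F j)) = \sum_(j <- r) tau (updi x i (F j)).
Proof.
elim: r => [|j r IHr]; first by rewrite !big_nil tau_upd0.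
by rewrite !big_cons -IHr -[F j in LHS]scale1r tau_lin scale1r.
Qed.

Inductive tensor_sum (P : (forall i, M i) -> Prop) : T -> Prop :=
| tensor_sum0 : tensor_sum P 0
| tensor_sumD c x t : P x -> tensor_sum P t -> tensor_sum P (c *: tau x + t).

Lemma tensor_sum_subspace P : subspace (tensor_sum P).
Proof.
split=> [|a t u]; first exact: tensor_sum0.
elim=> [|c x {}t Px _ IH] su; first by rewrite scaler0 add0r.
by rewrite scalerDr scalerA -addrA; apply: tensor_sumD => //; exact: IH.
Qed.

(** tau factors through the span U of the pure tensors; by uniqueness the composite T -> U -> T is
    the identity. *)
Lemma tensor_sumT t : tensor_sum (fun=> True) t.
Proof.
have [U [f [f_inj fS Sf]]] := subspace_module (tensor_sum_subspace (fun=> True)).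
have tau_in x : tensor_sum (fun=> True) (tau x).
  rewrite -[tau x]addr0 -[tau x]scale1r.
  by apply: tensor_sumD => //; exact: tensor_sum0.
have /choice[g gE] : forall x, exists u, f u = tau x by move=> x; apply: Sf.
have [_ univ] := Htau.
have g_lin : multilinear g.
  by move=> i x a y z; apply: f_inj; rewrite linearP !gE tau_lin.
have [[h hE] _] := univ U g g_lin.
have [_ uniq_h] := univ T tau tau_lin.
pose fh : {linear T -> T} := (f \o h)%FUN.
have fhE : fh t = t by apply: (uniq_h fh idfun) => x; rewrite /= hE gE.
rewrite -fhE; exact: fS.
Qed.

(** The rank one operator w -> mu(w) y on the i-th factor, tensored with the identity of the
    others. *)
Definition slot_op (h : T -> T) i (mu : M i -> K) (y : M i) : Prop :=
  forall x, h (tau x) = mu (x i) *: tau (updi x i y).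

Lemma slot_op_exists i (mu : M i -> K) y : scalar mu ->
  exists h : {linear T -> T}, slot_op h mu y.
Proof.
move=> mu_lin; have [_ univ] := Htau.
have f_lin : multilinear (fun x => mu (x i) *: tau (updi x i y)).
  move=> j x a z w; have [eij|ne] := eqVneq i j.
    case: j / eij z w => z w; rewrite !upd_in !upd_upd mu_lin.
    by rewrite scalerDl scalerA.
  have comm (u : M j) : updi (updi x j u) i y = updi (updi x i y) j u.
    by rewrite updC // eq_sym.
  rewrite !upd_out 1?eq_sym // !comm tau_lin scalerDr !scalerA.
  by rewrite [a * _]mulrC.
by have [[h hE] _] := univ T _ f_lin; exists h.
Qed.

End TensorProducts.

(** * Irreducibility of the outer tensor product *)

Section OuterTensorProduct.
Variables (R : realType) (e : sign) (N : nat) (m : 'I_N -> nat) (s : 'I_N -> R[i]).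
Local Notation C := R[i].
Local Notation G i := (@g_comp R e (m i) (s i)).

Variables (Lam : forall i, glhat R (m i) -> C^o) (L : 'I_N -> lmodType C).
Variable actL : forall i, glhat R (m i) -> L i -> L i.
Hypothesis HL : forall i, irr_highest_weight_module (G i) (@glhat_br R (m i))
  (@glhat_deg R (m i)) (@actL i) (@Lam i).

Variables (T : lmodType C) (tau : (forall i, L i) -> T).
Variable act : gvec_space R m -> T -> T.
Hypothesis Htau : is_tensor_product tau.
Hypothesis Houter : outer_action e s tau actL act.

Implicit Types (x : forall i, L i).
Local Notation updi x i y := (@upd C N L x i y).

Let Hact : lie_module (gvec e s) (@gvec_br R N m) act. Proof. by case: Houter. Qed.
Let irrL i : irreducible_module (G i) (@glhat_br R (m i)) (@actL i).
Proof. by case: (HL i). Qed.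
Let lieL i : lie_module (G i) (@glhat_br R (m i)) (@actL i).
Proof. by case: (irrL i). Qed.

Lemma outer_single i a x : G i a ->
  act (single a) (tau x) = tau (updi x i (actL a (x i))).
Proof.
move=> ga; case: Houter => _ ->; last exact: gvec_single.
rewrite (bigD1 i) //= single_in big1 ?addr0 // => j ne.
rewrite single_out 1?eq_sym // (act0v (g_comp_subspace _ _ _ _) (lieL j)).
exact: tau_upd0.
Qed.

(** Smoothness concerns one vector at a time, and that vector is a finite sum of pure tensors. *)
Lemma outer_smooth :
  (forall i, smooth (symm e (s i)) (epsi e (s i)) (esgn R e) (@actL i)) ->
  component_smooth e s act.
Proof.
move=> smoothL i t k k0; elim: (tensor_sumT Htau t) => [|c x {}t _ _ [B HB]].
  exists 0%N => a sa _; apply: (actr0 Hact); apply: gvec_single.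
  by rewrite g_compE; exact: symg_band.
have [B' HB'] := smoothL i (x i) k k0; exists (maxn B B') => a sa a0.
have ga : G i (band k a 0) by rewrite g_compE; exact: symg_band.
have gs : gvec e s (single (band k a 0 : glhat R (m i))) by exact: gvec_single.
rewrite (actD Hact) // (actZ Hact) // outer_single // HB' => [||j le_j] //.
  rewrite (tau_upd0 Htau) scaler0 add0r HB // => j le_j.
  by apply: a0; rewrite leq_max le_j.
by apply: a0; rewrite leq_max le_j orbT.
Qed.

Let eul i : glhat R (m i) := @euler R (m i) (epsi e (s i)).

Let eul_G i : G i (eul i).
Proof. by rewrite g_compE; apply: euler_symg; [exact: esgnM | exact: esgn_sq]. Qed.

Let hw_data i : exists (v : L i) (lam : L i -> C),
  [/\ scalar lam, lam v = 1 & forall w, exists M0 : nat, forall M, (M0 <= M)%N ->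
     spectral_proj (actL (eul i)) (Lam (eul i)) M w = lam w *: v].
Proof.
have := HL i; rewrite /irr_highest_weight_module g_compE.
case=> _ irr [v [v0 vpos vzero]].
exists v; apply: (hw_functional _ _ irr v0 vpos vzero).
- exact: esgnM.
- exact: esgn_sq.
Qed.

Let v i : L i := sval (cid (hw_data i)).
Let lam i : L i -> C := sval (cid (svalP (cid (hw_data i)))).
Let lamP i : [/\ scalar (@lam i), lam (v i) = 1 &
  forall w, exists M0 : nat, forall M, (M0 <= M)%N ->
     spectral_proj (actL (eul i)) (Lam (eul i)) M w = lam w *: v i].
Proof. exact: svalP (cid (svalP (cid (hw_data i)))). Qed.

Let lam_scalar i : scalar (@lam i). Proof. by case: (lamP i). Qed.
Let lam_v i : lam (v i) = 1. Proof. by case: (lamP i). Qed.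

Let dual i := dual_orbit (G i) (@actL i) (@lam i).

Let dual_scalar i mu : dual mu -> scalar (mu : L i -> C).
Proof. exact: (dual_orbit_scalar (irrL i) (@lam_scalar i)). Qed.

Lemma tensor_ext (f f' : T -> T) : linear f -> linear f' ->
  (forall x, f (tau x) = f' (tau x)) -> f =1 f'.
Proof.
move=> f_lin f'_lin ff' t; elim: (tensor_sumT Htau t) => [|c x {}t _ _ IH].
  by rewrite !linear_at0.
by rewrite f_lin f'_lin ff' IH.
Qed.

Section Submodule.
Variable W : set T.
Hypothesis HW : submodule (gvec e s) act W.

Let W0 : W 0. Proof. by case: HW => -[]. Qed.
Let Wlin c t u : W t -> W u -> W (c *: t + u).
Proof. by case: HW => -[_ +] _; apply. Qed.
Let WZ c t : W t -> W (c *: t).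
Proof. by move=> Wt; rewrite -[_ *: _]addr0; exact: Wlin. Qed.
Let Wact a t : gvec e s a -> W t -> W (act a t).
Proof. by case: HW => _; apply. Qed.

(** On the finitely many pure tensors of t, h agrees with a spectral projection of the Euler element
    of the i-th summand, and this projection preserves W. *)
Lemma submodule_slot_gen i (h : {linear T -> T}) t :
  slot_op tau h (@lam i) (v i) -> W t -> W (h t).
Proof.
move=> hE Wt; have gse : gvec e s (single (eul i)) by exact: gvec_single.
pose D := act (single (eul i)); pose p := spectral_proj D (Lam (eul i)).
have D_lin : linear D by case: Hact => + _ _; apply.
have Wp M : W (p M t).
  elim: M => // M IHM; apply: WZ; rewrite -[D _]scale1r; apply: Wlin.
    exact: Wact.
  exact: WZ.
have p_tau M x : p M (tau x) =
    tau (updi x i (spectral_proj (actL (eul i)) (Lam (eul i)) M (x i))).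
  elim: M => [|M IHM] /=; first by rewrite upd_id.
  rewrite -/(p M (tau x)) IHM /D outer_single // upd_upd upd_in.
  by rewrite (tau_updZ Htau) -[actL _ _ in RHS]scale1r (tau_upd_linear Htau)
    scale1r (tau_updZ Htau).
suff [M ->] : exists M, h t = p M t by [].
suff [M0 HM] : exists M0 : nat, forall M, (M0 <= M)%N -> h t = p M t.
  by exists M0; exact: HM.
elim: (tensor_sumT Htau t) => [|c x {Wt Wp}t _ _ [M0 HM]].
  exists 0%N => M _; rewrite linear0 /p linear_at0 //.
  exact: spectral_proj_linear.
have [_ _ /(_ (x i)) [M1 HM1]] := lamP i; exists (maxn M0 M1) => M.
rewrite geq_max => /andP[leM0 leM1].
rewrite linearP (HM M leM0) /p (spectral_proj_linear _ D_lin) -/(p M (tau x)).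
by rewrite p_tau (HM1 M leM1) (tau_updZ Htau) hE.
Qed.

(** Composing mu with the action of a amounts to composing its slot operator with that of
    [single a], which preserves W; so the property spreads from [lam] over its orbit. *)
Lemma submodule_slot i (mu : L i -> C) (h : {linear T -> T}) t : dual mu ->
  slot_op tau h mu (v i) -> W t -> W (h t).
Proof.
move=> dmu; elim: dmu h t => {mu}
  [|a mu ga dmu IH|c mu mu' dmu IH dmu' IH'] h t hE Wt.
- exact: submodule_slot_gen hE Wt.
- have [h1 h1E] := slot_op_exists Htau (v i) (dual_scalar dmu).
  have gsa : gvec e s (single a) by exact: gvec_single.
  rewrite (@tensor_ext h (fun u => h1 (act (single a) u))).
  + by apply: IH h1E _; exact: Wact.
  + exact: linearP.
  + by move=> b u w; rewrite (actD Hact) // (actZ Hact) // linearP.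
  by move=> x; rewrite hE outer_single // h1E upd_in upd_upd.
have [h1 h1E] := slot_op_exists Htau (v i) (dual_scalar dmu).
have [h2 h2E] := slot_op_exists Htau (v i) (dual_scalar dmu').
rewrite (@tensor_ext h (fun u => c *: h1 u + h2 u)).
- by apply: Wlin; [exact: IH h1E Wt | exact: IH' h2E Wt].
- exact: linearP.
- move=> b u w; rewrite [h1 _]linearP [h2 _]linearP.
  by rewrite !scalerDr !scalerA [c * b]mulrC addrACA.
by move=> x; rewrite hE h1E h2E scalerA -scalerDl.
Qed.

End Submodule.

(** A dual system for the i-th entries of t recovers t as the sum of the k_p (h_p t), where h_p
    contracts the slot to v and k_p puts p.2 in place of v; hence some h_p t is nonzero. *)
Lemma slot_nonzero i t : t <> 0 ->
  exists mu : L i -> C, dual mu /\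
    forall h : {linear T -> T}, slot_op tau h mu (v i) -> h t <> 0.
Proof.
move=> t0; apply: contrapT => none; apply: t0.
have [ws ws_t] : exists ws : seq (L i), forall F : T -> T, linear F ->
    (forall x, x i \in ws -> F (tau x) = tau x) -> F t = t.
  elim: (tensor_sumT Htau t) => [|c x {none}t _ _ [ws IH]].
    by exists [::] => F F_lin _; exact: linear_at0.
  exists (x i :: ws) => F F_lin Fx; rewrite F_lin Fx ?mem_head // IH // => y y_ws.
  by rewrite Fx // inE y_ws orbT.
have [r [dr wsE]] := dual_system (irrL i) (@lam_scalar i) (@lam_v i) ws.
have /choice[h hE] : forall p : (L i -> C) * L i, exists h : {linear T -> T},
    dual p.1 -> slot_op tau h p.1 (v i).
  move=> p; have [dp|ndp] := pselect (dual p.1); last by exists \0.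
  by have [h hE] := slot_op_exists Htau (v i) (dual_scalar dp); exists h.
have /choice[k kE] : forall p : (L i -> C) * L i, exists k : {linear T -> T},
    slot_op tau k (@lam i) p.2.
  by move=> p; exact: slot_op_exists (@lam_scalar i).
have h0 p : List.In p r -> h p t = 0.
  move=> p_r; apply: contrapT => hp; apply: none; exists p.1.
  split; first exact: dr.
  move=> h' h'E; rewrite (@tensor_ext h' (h p)) //.
  - exact: linearP.
  - exact: linearP.
  by move=> x; rewrite h'E hE //; exact: dr.
pose F u := \sum_(p <- r) k p (h p u).
have F_lin : linear F.
  move=> c x y; rewrite /F scaler_sumr -big_split; apply: eq_bigr => p _.
  by rewrite !linearP.
have F_tau x : F (tau x) = tau (updi x i (\sum_(p <- r) p.1 (x i) *: p.2)).
  rewrite /F (tau_upd_sum Htau); elim: (r) dr => [|p r' IH] dr'.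
    by rewrite !big_nil.
  rewrite !big_cons IH => [|q q_r]; last by apply: dr'; right.
  congr (_ + _); rewrite hE; last by apply: dr'; left.
  by rewrite linearZ /= kE upd_in lam_v scale1r upd_upd (tau_updZ Htau).
rewrite -(ws_t F) // => [|x x_ws]; last by rewrite F_tau -wsE // upd_id.
rewrite /F; elim: (r) h0 => [|p r' IH] h0; first by rewrite big_nil.
rewrite big_cons h0; last by left.
by rewrite linear0 add0r IH // => q q_r; apply: h0; right.
Qed.

(** The product of the [lam] is a multilinear form with value 1 at v, and it factors through T. *)
Lemma tau_hw_nonzero : tau v <> 0.
Proof.
pose f x : C^o := \prod_i lam (x i).
have f_lin : multilinear f.
  move=> i x a y z.
  have fE w : f (updi x i w) = lam w * \prod_(j | j != i) lam (x j).
    rewrite /f (bigD1 i) //= upd_in; congr (_ * _); apply: eq_bigr => j ne.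
    by rewrite upd_out 1?eq_sym.
  by rewrite !fE lam_scalar mulrDl -mulrA.
have [_ /(_ _ f f_lin) [[h hE] _]] := Htau.
move=> tau0; have := hE v; rewrite tau0 linear0 /f big1 // => /eqP.
by rewrite eq_sym oner_eq0.
Qed.

Lemma submodule_tau_hw W : submodule (gvec e s) act W ->
  (exists2 t, W t & t <> 0) -> W (tau v).
Proof.
move=> HW [t Wt t0]; have [[W0 Wlin] _] := HW.
(* The slot operator of index n overwrites that entry with v and keeps the earlier ones; at n = N a
   nonzero multiple of tau v remains. *)
have chain n : (n <= N)%N -> exists t', [/\ W t', t' <> 0 &
    tensor_sum tau (fun x => forall i : 'I_N, (i < n)%N -> x i = v i) t'].
  elim: n => [_|n IHn lt_nN].
    exists t; split=> //; elim: (tensor_sumT Htau t) => [|c x u _ _ IH].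
      exact: tensor_sum0.
    exact: tensor_sumD.
  have [t' [Wt' t'0 t'S]] := IHn (ltnW lt_nN); pose i := Ordinal lt_nN.
  have [mu [dmu mu_t']] := slot_nonzero i t'0.
  have [h hE] := slot_op_exists Htau (v i) (dual_scalar dmu).
  exists (h t'); split.
  - exact: submodule_slot HW _ _ _ _ dmu hE Wt'.
  - exact: mu_t'.
  elim: t'S => [|c x u xv _ IH]; first by rewrite linear0; exact: tensor_sum0.
  rewrite linearP hE scalerA; apply: tensor_sumD => // j.
  rewrite ltnS leq_eqVlt => /predU1P[ej|lt_j].
    have -> : j = i by apply: val_inj.
    by rewrite upd_in.
  rewrite upd_out ?xv //; apply: contraTneq lt_j => <-.
  by rewrite ltnn.
have [t' [Wt' t'0 t'S]] := chain N (leqnn N).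
have [c Ec] : exists c, t' = c *: tau v.
  elim: t'S => [|c x u xv _ [c' ->]]; first by exists 0; rewrite scale0r.
  exists (c + c'); rewrite scalerDl; congr (_ *: tau _ + _).
  by apply: functional_extensionality_dep => i; exact: xv.
have c0 : c != 0 by apply: contra_not_neq t'0 => c0; rewrite Ec c0 scale0r.
rewrite -[tau v]scale1r -(mulVf c0) -scalerA -Ec -[_ *: _]addr0.
exact: Wlin.
Qed.

(** With the other entries fixed, the y whose tensor lies in W form a submodule of L i containing v
    i, hence all of L i. *)
Lemma submodule_tau W : submodule (gvec e s) act W -> W (tau v) ->
  forall x, W (tau x).
Proof.
move=> HW Wv; have [[W0 Wlin] Wact] := HW.
suff H n : (n <= N)%N ->
    forall x, (forall i : 'I_N, (n <= i)%N -> x i = v i) -> W (tau x).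
  by move=> x; apply: (H N) => // i; rewrite leqNgt ltn_ord.
elim: n => [_ x xv|n IHn lt_nN x xv].
  have -> // : x = v by apply: functional_extensionality_dep => i; exact: xv.
pose i := Ordinal lt_nN; pose U : set (L i) := [set y | W (tau (updi x i y))].
have tauZ := tau_upd_linear Htau x (i := i).
have [U0|UT] : U = [set 0] \/ U = setT.
- case: (irrL i) => _ _; apply; split.
    split=> [|a y z Uy Uz]; first by rewrite /U /= (tau_upd0 Htau).
    by rewrite /U /= tauZ; exact: Wlin.
  move=> a y ga Uy; have := Wact _ _ (gvec_single ga) Uy.
  by rewrite outer_single // upd_in upd_upd.
- have Uv : U (v i).
    apply: IHn => [|j le_j]; first exact: ltnW.
    have [<-|ne] := eqVneq i j; first by rewrite upd_in.
    rewrite upd_out // xv // ltn_neqAle le_j andbT.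
    by apply: contra_neq ne => ej; apply: val_inj.
  have v0 : v i = 0 by have : [set 0] (v i) by rewrite -U0.
  have := lam_v i; rewrite v0 (scalar_at0 (@lam_scalar i)) => /eqP.
  by rewrite eq_sym oner_eq0.
have : U (x i) by rewrite UT.
by rewrite /U /= upd_id.
Qed.

Lemma outer_irreducible : irreducible_module (gvec e s) (@gvec_br R N m) act.
Proof.
split=> //; first by exists (tau v); exact: tau_hw_nonzero.
move=> W HW; have [[W0 Wlin] _] := HW.
have [Wt|nWt] := pselect (exists2 t, W t & t <> 0); [right|left].
  apply/seteqP; split=> // t _; have Wv := submodule_tau_hw HW Wt.
  elim: (tensor_sumT Htau t) => [//|c x u _ _ Wu].
  by apply: Wlin => //; exact: submodule_tau.
apply/seteqP; split=> [t Wt|t ->//].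
by apply: contrapT => t0; apply: nWt; exists t.
Qed.

End OuterTensorProduct.

Lemma dhat_lie_module (R : realType) (e : sign) (N : nat) (m : 'I_N -> nat)
    (s : 'I_N -> R[i]) (V : lmodType R[i]) (act : gvec_space R m -> V -> V) :
  lie_module (gvec e s) (@gvec_br R N m) act ->
  lie_module (dhat_pm e) (@dhat_br R) (fun x => act (phihat_vec m s x)).
Proof.
case=> act_lin act_linl act_br; split=> [x Dx|v a x y Dx Dy|x y v Dx Dy].
- by apply: act_lin; exact: phihat_vec_gvec.
- rewrite -act_linl; try exact: phihat_vec_gvec.
  by congr act; apply: gvec_eqP => i; exact: phihat_is_linear.
rewrite -act_br; try exact: phihat_vec_gvec.
congr act; apply: gvec_eqP => i; apply: phihat_br; first by case: Dx.
by case: Dy.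
Qed.

Theorem theorem6p1 (R : realType) (e : sign) (N : nat) (m : 'I_N -> nat)
    (s : 'I_N -> R[i]) (hN : (1 <= N)%N) (hs : star e s) :
  (forall (V : lmodType R[i]) (act : gvec_space R m -> V -> V),
     quasifinite (gvec e s) (@gvec_br R N m) (@gvec_deg R N m) act ->
     odd_center_zero s act ->
     forall W : set V,
       submodule (dhat_pm e) (fun x => act (phihat_vec m s x)) W ->
       submodule (gvec e s) act W)
  /\
  (forall (Lam : forall i, glhat R (m i) -> R[i]^o)
          (L : 'I_N -> lmodType R[i])
          (actL : forall i, glhat R (m i) -> L i -> L i),
     (forall i, irr_highest_weight_module (g_comp e (s i)) (@glhat_br R (m i))
                  (@glhat_deg R (m i)) (actL i) (Lam i)) ->
     (forall i, quasifinite (g_comp e (s i)) (@glhat_br R (m i))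
                  (@glhat_deg R (m i)) (actL i)) ->
     forall (T : lmodType R[i]) (tau : (forall i, L i) -> T)
            (act : gvec_space R m -> T -> T),
       is_tensor_product tau ->
       outer_action e s tau actL act ->
       odd_center_zero s act ->
       irreducible_module (dhat_pm e) (@dhat_br R)
         (fun x => act (phihat_vec m s x))).
Proof.
split=> [V act [Hact Hqf] odd0 W HW|Lam L actL HL Lqf T tau act Htau Houter odd0].
  exact: (smooth_submodule Hact (quasifinite_component_smooth Hact Hqf) hs odd0 HW).
have [Hact T_neq0 Wirr] := outer_irreducible HL Htau Houter.
split=> //; first exact: dhat_lie_module.
have smoothL i : smooth (symm e (s i)) (epsi e (s i)) (esgn R e) (actL i).
  have := Lqf i; rewrite /quasifinite g_compE => -[HactL HqfL].
  exact: (quasifinite_smooth (@esgnM R e) (@esgn_sq R e) HactL HqfL).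
move=> W HW; apply: Wirr.
exact: (smooth_submodule Hact (outer_smooth HL Htau Houter smoothL) hs odd0 HW).
Qed.
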